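(* Let $X$ be a locally compact second countable topological space equipped with a Radon measure $\lambda$, let $\Gamma$ be a locally compact second countable group acting continuously on $X$ and preserving the measure $\lambda$, and let $\mu$ be a probability measure on $\Gamma$ whose support generates $\Gamma$ as a closed group (i.e. the smallest closed subgroup of $\Gamma$ containing the support of $\mu$ is $\Gamma$). If the probability measure $\mu$ is symmetric and if every measurable $\Gamma$-invariant subset of $X$ has zero or infinite $\lambda$-measure, then for $\lambda$-almost every $x\in X$, one has the weak-$\ast$ convergence $$\mu^{\ast n}\ast \delta_{x} \underset{n \to +\infty}{\longrightarrow} 0.$$
   Context: A probability measure $\mu$ on $\Gamma$ is symmetric if it is invariant under the inversion map $g\mapsto g^{-1}$. A measurable subset $A\subseteq X$ is called $\Gamma$-invariant if for every $g\in\Gamma$ one has $\lambda(gA\,\Delta\, A)=0$. For $x\in X$, $\mu^{\ast n}\ast\delta_x$ is the law of the $n$-th step of the $\mu$-random walk on $X$ started at $x$, i.e. the image of the $n$-fold convolution power $\mu^{\ast n}$ under the map $\Gamma\to X$, $g\mapsto g.x$. Weak-$\ast$ convergence of a sequence of finite measures $\nu_n$ on $X$ to a finite measure $\nu$ means $\int_X f\,d\nu_n\to\int_X f\,d\nu$ for every continuous compactly supported function $f:X\to\mathbb{R}$; in particular convergence to $0$ means $\int_X f\,d\nu_n\to 0$ for all such $f$. *)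

(* Defs.v *)
From HB Require Import structures.
From mathcomp Require Import all_boot all_order all_algebra.
From mathcomp Require Import all_classical all_reals all_analysis.

Set Implicit Arguments.
Unset Strict Implicit.
Unset Printing Implicit Defensive.

Import Order.TTheory GRing.Theory Num.Theory.
Import numFieldNormedType.Exports.

Local Open Scope classical_set_scope.
Local Open Scope ring_scope.

(* The point of [PointedTopological] plays no role: it is only there because
   the library equips pointed types with sigma-algebras. *)
HB.mixin Record PointedTopological_isTopologicalGroup G
    & PointedTopological G & Group G := {
  mulg_continuous : continuous (fun p : G * G => (p.1 * p.2)%g) ;
  invg_continuous : continuous (fun g : G => (g^-1)%g)
}.

#[short(type="topologicalGroupType")]
HB.structure Definition TopologicalGroup :=
  {G of PointedTopological G & Group G
      & PointedTopological_isTopologicalGroup G}.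

(* [T] with its Borel sigma-algebra; convertible to [T]. *)
Notation borel T := (g_sigma_algebraType (@open T)).

(* Locally compact spaces are Hausdorff, as usual when Radon measures are
   considered. *)
Definition lcsc (T : topologicalType) :=
  [/\ hausdorff_space T, locally_compact [set: T] & @second_countable T].

Definition closed_subgroup (G : topologicalGroupType) (H : set G) :=
  closed H /\ group_closed (fun g => g \in H).

Definition continuous_action (G : topologicalGroupType) (X : topologicalType)
    (act : G -> X -> X) :=
  [/\ forall x, act 1%g x = x,
      forall g h x, act (g * h)%g x = act g (act h x) &
      continuous (fun p : G * X => act p.1 p.2)].

Section measures.
Local Open Scope ereal_scope.
Context {R : realType}.

Definition radon (X : ptopologicalType) (la : set (borel X) -> \bar R) :=
  [/\ forall K : set X, compact K -> la K < +oo,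
      forall A : set (borel X), measurable A ->
        la A = ereal_inf [set la U | U in [set U : set X | open U /\ A `<=` U]] &
      forall U : set X, open U ->
        la U = ereal_sup [set la K | K in [set K | compact K /\ K `<=` U]]].

Definition measure_preserving_action (G : topologicalGroupType)
    (X : ptopologicalType) (act : G -> X -> X)
    (la : set (borel X) -> \bar R) :=
  forall (g : G) (A : set (borel X)), measurable A ->
    pushforward la (act g : borel X -> borel X) A = la A.

(* Invariance is up to null sets, with one null set for each [g]. *)
Definition invariant_set (G : topologicalGroupType)
    (X : ptopologicalType) (act : G -> X -> X)
    (la : set (borel X) -> \bar R) (A : set X) :=
  forall g : G, la ((act g @` A) `+` A) = 0.

Definition measure_support (X : ptopologicalType)
    (mu : set (borel X) -> \bar R) : set X :=
  [set x | forall U : set X, open_nbhs x U -> 0 < mu U].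

Definition symmetric_measure (G : topologicalGroupType)
    (mu : set (borel G) -> \bar R) :=
  forall A : set (borel G), measurable A ->
    pushforward mu ((fun g => g^-1%g) : borel G -> borel G) A = mu A.

(* Multiplication is measurable for the product of the Borel sigma-algebras
   when [G] is second countable, so that in this case the image below is
   again a measure. *)
Definition convolution (G : topologicalGroupType)
    (mu nu : set (borel G) -> \bar R) : set (borel G) -> \bar R :=
  pushforward (mu \x nu)
    ((fun p => (p.1 * p.2)%g) : borel G * borel G -> borel G).

Definition convolution_power (G : topologicalGroupType)
    (mu : set (borel G) -> \bar R) (n : nat) : set (borel G) -> \bar R :=
  iter n (convolution mu) (\d_(1%g : borel G)).

Definition walk_law (G : topologicalGroupType) (X : ptopologicalType)
    (act : G -> X -> X) (mu : set (borel G) -> \bar R) (n : nat) (x : X) :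
    set (borel X) -> \bar R :=
  pushforward (convolution_power mu n)
    ((fun g => act g x) : borel G -> borel X).

Definition weak_star_cvg (X : ptopologicalType)
    (nu_ : nat -> set (borel X) -> \bar R) (nu : set (borel X) -> \bar R) :=
  forall f : X -> R, continuous f -> compact (closure [set x | f x != 0%R]) ->
    (\int[nu_ n]_x (f x)%:E) @[n --> \oo] --> \int[nu]_x (f x)%:E.

End measures.

(* Main.v *)
Require Import Defs.
From HB Require Import structures.
From mathcomp Require Import all_boot all_order all_algebra.
From mathcomp Require Import all_classical all_reals all_analysis.
From mathcomp Require Import measurable_realfun.
From mathcomp Require Import ring lra zify.
Import numFieldNormedType.Exports.

(** Write [P f x] for the mean of [f (g x)] when [g] has law [mu]. The n-th
    step of the walk from [x] integrates [f] to [P^n f x]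
    (walk_law_markov_op), and [X] is exhausted by countably many open sets
    [V] of finite measure, such that every compact set lies in one of them.
    So it suffices that [P^n 1_V] tends to [0] almost everywhere, for each
    of these sets [V].

    As [la] is invariant and [mu] symmetric, [P] is symmetric for [la]: this
    is detailed balance (markov_op_reversible). The proof for a reversible
    operator [P] and a bounded integrable [f >= 0] has three ingredients.

    Averages. The upper limit [h] of the averages of the iterates [P^n f]
    satisfies [h <= P h] by Fatou's lemma, and its superlevel sets have
    finite measure by the maximal inequality of Hopf (birkhoff_sum_maximal).
    By Jensen, the positive part of [h - e] is again subharmonic; being
    integrable, it is harmonic, so that from almost every point outside the
    set [E = {h > e}] the walk almost surely stays outside
    (subharmonic_superlevel).

    Invariant sets. For a set [E] of finite measure that the walk does not
    enter from outside, [mu]-almost every [g] preserves [E] up to a null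
    set. The elements of [G] with this property form a subgroup, closed by
    regularity of [la], hence the whole of [G] (stabilizer_setT). By
    hypothesis [E] is then null, so [h = 0] almost everywhere.

    From averages to iterates. Averages are not enough, and [P^n f] itself
    may fail to converge in general because [-1] can belong to the spectrum
    of [P]; this does not affect the even iterates [w n = P^(2n) f]. The
    series of the [k * (w (k+1) - w k)^2] is integrable, because the
    integrals of the squares are second differences of the nonincreasing
    convex sequence of the square norms of [P^j f] (square_function_fin). Where the series converges, [w]
    follows its averages (cvg0_of_cesaro), and these are bounded by twice
    those of [f]. The odd iterates are the even iterates of [P f]. *)

Set Implicit Arguments.
Unset Strict Implicit.
Unset Printing Implicit Defensive.

Import Order.TTheory GRing.Theory Num.Theory.

Local Open Scope classical_set_scope.
Local Open Scope ring_scope.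

(** * Bounded nonnegative measurable functions *)

Section bounded_functions.
Context {d} {T : measurableType d} {R : realType}.
Implicit Types f h : T -> R.

(** Boundedness makes the means real numbers, so that the operator below acts on
    real-valued functions; nonnegativity makes all integrals meaningful and
    Tonelli's theorem applicable without integrability. *)
Definition bounded_nneg_mfun f :=
  [/\ measurable_fun setT f, forall x, 0 <= f x & exists M, forall x, f x <= M].

Lemma bounded_nneg_EFin f : bounded_nneg_mfun f ->
  measurable_fun setT (EFin \o f).
Proof. by case=> mf _ _; exact/measurable_EFinP. Qed.

Lemma bounded_nneg_cst (c : R) : 0 <= c -> bounded_nneg_mfun (cst c).
Proof. by move=> c0; split => //; exists c. Qed.

Lemma bounded_nneg_add f h : bounded_nneg_mfun f -> bounded_nneg_mfun h ->
  bounded_nneg_mfun (fun x => f x + h x).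
Proof.
move=> [mf f0 [M fM]] [mh h0 [N hN]]; split; first exact: measurable_funD.
- by move=> x; rewrite addr_ge0.
- by exists (M + N) => x; rewrite lerD.
Qed.

Lemma bounded_nneg_mul f h : bounded_nneg_mfun f -> bounded_nneg_mfun h ->
  bounded_nneg_mfun (fun x => f x * h x).
Proof.
move=> [mf f0 [M fM]] [mh h0 [N hN]]; split; first exact: measurable_funM.
- by move=> x; rewrite mulr_ge0.
- by exists (M * N) => x; rewrite ler_pM.
Qed.

Lemma bounded_nneg_sqr f : bounded_nneg_mfun f ->
  bounded_nneg_mfun (fun x => f x ^+ 2).
Proof. by move=> bf; exact: bounded_nneg_mul. Qed.

Lemma bounded_nneg_max0B f h : bounded_nneg_mfun f -> bounded_nneg_mfun h ->
  bounded_nneg_mfun (fun x => Num.max 0 (f x - h x)).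
Proof.
move=> [mf f0 [M fM]] [mh h0 _]; split.
- by apply: measurable_maxr => //; exact: measurable_funB.
- by move=> x; rewrite le_max lexx.
- exists M => x; rewrite ge_max (le_trans (f0 x) (fM x))/=.
  by rewrite (le_trans _ (fM x))// gerBl.
Qed.

Lemma bounded_nneg_indic (A : set T) : measurable A ->
  bounded_nneg_mfun (\1_A : T -> R).
Proof.
move=> mA; split; first exact: measurable_indic.
- by move=> x.
- by exists 1 => x; rewrite indicE; case: (_ \in _).
Qed.

Lemma bounded_nneg_sqr_diff f h : bounded_nneg_mfun f -> bounded_nneg_mfun h ->
  bounded_nneg_mfun (fun x => (f x - h x) ^+ 2).
Proof.
move=> [mf f0 [M fM]] [mh h0 [N hN]]; split.
- by apply: measurable_funX; exact: measurable_funB.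
- by move=> x; rewrite sqr_ge0.
- exists (M ^+ 2 + N ^+ 2) => x.
  have := f0 x; have := h0 x; have := fM x; have := hN x; nra.
Qed.

Lemma ge0_int_EFin (m : {measure set T -> \bar R}) f : (forall x, 0 <= f x) ->
  (0 <= \int[m]_x (f x)%:E)%E.
Proof. by move=> f0; apply: integral_ge0 => x _; rewrite lee_fin. Qed.

Lemma int_EFinD (m : {measure set T -> \bar R}) f h :
  bounded_nneg_mfun f -> bounded_nneg_mfun h ->
  (\int[m]_x (f x + h x)%:E = \int[m]_x (f x)%:E + \int[m]_x (h x)%:E)%E.
Proof.
move=> bf bh; under eq_integral do rewrite EFinD.
rewrite ge0_integralD//; try exact: bounded_nneg_EFin.
- by move=> x _; rewrite lee_fin; case: bf.
- by move=> x _; rewrite lee_fin; case: bh.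
Qed.

Lemma int_EFinZ (m : {measure set T -> \bar R}) (c : R) f :
  0 <= c -> bounded_nneg_mfun f ->
  (\int[m]_x (c * f x)%:E = c%:E * \int[m]_x (f x)%:E)%E.
Proof.
move=> c0 bf; under eq_integral do rewrite EFinM.
rewrite ge0_integralZl_EFin//; last exact: bounded_nneg_EFin.
by move=> x _; rewrite lee_fin; case: bf.
Qed.

Lemma le_int_EFin (m : {measure set T -> \bar R}) f h :
  bounded_nneg_mfun f -> bounded_nneg_mfun h -> (forall x, f x <= h x) ->
  (\int[m]_x (f x)%:E <= \int[m]_x (h x)%:E)%E.
Proof.
move=> bf bh fh; apply: ge0_le_integral => //; try exact: bounded_nneg_EFin.
- by move=> x _; rewrite lee_fin; case: bf.
- by move=> x _; rewrite lee_fin.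
Qed.

(** Only finite integrals are compared: two functions of infinite integral may
    be ordered without being equal almost everywhere. *)
Lemma ae_eq_of_le_int (m : {measure set T -> \bar R}) f h :
  bounded_nneg_mfun f -> bounded_nneg_mfun h -> (forall x, f x <= h x) ->
  (\int[m]_x (h x)%:E = \int[m]_x (f x)%:E)%E ->
  (\int[m]_x (f x)%:E < +oo)%E -> {ae m, forall x, h x = f x}.
Proof.
move=> bf bh fh hf foo.
have bd : bounded_nneg_mfun (fun x => Num.max 0 (h x - f x)).
  exact: bounded_nneg_max0B.
have dE x : Num.max 0 (h x - f x) = h x - f x.
  by apply/max_idPr; rewrite subr_ge0.
have ffin : (\int[m]_x (f x)%:E)%E \is a fin_num.
  by rewrite ge0_fin_numE// ge0_int_EFin//; case: bf.
have d0 : (\int[m]_x (Num.max 0 (h x - f x))%:E = 0)%E.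
  have -> : (\int[m]_x (Num.max 0 (h x - f x))%:E =
      \int[m]_x (f x)%:E + \int[m]_x (Num.max 0 (h x - f x))%:E
      - \int[m]_x (f x)%:E)%E by rewrite addeAC subee// add0e.
  rewrite -int_EFinD// -[in X in (_ - X)%E]hf.
  under eq_integral do rewrite dE subrKC.
  by rewrite subee// hf.
have : ae_eq m setT (EFin \o (fun x => Num.max 0 (h x - f x))) (cst 0%E).
  apply/ae_eq_integral_abs => //; first exact: bounded_nneg_EFin.
  rewrite -d0; apply: eq_integral => x _ /=.
  by rewrite ger0_norm// le_max lexx.
apply: filterS => x /(_ I)/= [].
by rewrite dE => /eqP; rewrite subr_eq0 => /eqP.
Qed.

Lemma int0_ae_eq0 (m : {measure set T -> \bar R}) f :
  bounded_nneg_mfun f -> (\int[m]_x (f x)%:E = 0)%E ->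
  {ae m, forall x, f x = 0}.
Proof.
move=> bf f0; apply: ae_eq_of_le_int => //.
- exact: (@bounded_nneg_cst 0).
- by case: bf.
- by rewrite f0 integral0.
- by rewrite integral0.
Qed.

Lemma measurable_superlevel f (a : R) : measurable_fun setT f ->
  measurable [set x | a < f x].
Proof.
move=> mf; rewrite -[X in measurable X]setTI.
have -> : [set x | a < f x] = f @^-1` `]a, +oo[%classic.
  by apply/seteqP; split => x /=; rewrite in_itv/= andbT.
exact: mf.
Qed.

End bounded_functions.

(** * The Markov operator of a random walk *)

Section markov_operator.
Context {dG dT} {G : measurableType dG} {T : measurableType dT} {R : realType}.
Variables (act : G -> T -> T) (mu : probability G R).
Implicit Types f h : T -> R.

Definition markov_op f (x : T) : R := fine (\int[mu]_g (f (act g x))%:E).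

Hypothesis mact : measurable_fun setT (fun p : G * T => act p.1 p.2).

Local Notation P := markov_op.

Lemma bounded_nneg_act f x : bounded_nneg_mfun f ->
  bounded_nneg_mfun (fun g => f (act g x)).
Proof.
move=> [mf f0 [M fM]]; split => //; last by exists M.
apply: measurableT_comp => //.
apply: (measurableT_comp mact (g := fun g : G => (g, x))).
exact: measurable_fun_pair.
Qed.

Lemma int_prob_cst x (c : R) :
  (\int[mu]_g ((cst c : T -> R) (act g x))%:E = c%:E)%E.
Proof.
have := @integral_cst _ _ _ mu _ measurableT c%:E.
by rewrite [X in (_ * X)%E](@probability_setT _ _ _ mu) mule1.
Qed.

Lemma int_prob_bounded f x (M : R) : bounded_nneg_mfun f ->
  (forall y, f y <= M) -> (\int[mu]_g (f (act g x))%:E <= M%:E)%E.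
Proof.
move=> bf fM; have M0 : 0 <= M by rewrite (le_trans _ (fM x))//; case: bf.
apply: (@le_trans _ _ (\int[mu]_g ((cst M : T -> R) (act g x))%:E)%E).
  apply: le_int_EFin => //; first exact: bounded_nneg_act.
  exact: bounded_nneg_cst.
by rewrite int_prob_cst.
Qed.

Lemma markov_opE f x : bounded_nneg_mfun f ->
  ((P f x)%:E = \int[mu]_g (f (act g x))%:E)%E.
Proof.
move=> bf; rewrite /P fineK// ge0_fin_numE.
  have [_ _ [M fM]] := bf.
  by rewrite (le_lt_trans (int_prob_bounded x bf fM))// ltry.
by apply: ge0_int_EFin => g; case: bf.
Qed.

Lemma markov_op_le_cst f (M : R) : bounded_nneg_mfun f ->
  (forall y, f y <= M) -> forall x, P f x <= M.
Proof.
by move=> bf fM x; rewrite -lee_fin markov_opE//; exact: int_prob_bounded.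
Qed.

Lemma bounded_nneg_markov_op f : bounded_nneg_mfun f -> bounded_nneg_mfun (P f).
Proof.
move=> bf; have [mf f0 [M fM]] := bf; split.
- apply: (@measurableT_comp _ _ _ _ _ _ (@fine R)) => //.
  have mF : measurable_fun setT (fun p : T * G => (f (act p.2 p.1))%:E).
    apply/measurable_EFinP; apply: measurableT_comp => //.
    apply: (measurableT_comp mact (g := fun p : T * G => (p.2, p.1))).
    exact: measurable_fun_pair.
  apply: (measurable_fun_fubini_tonelli_F (m2 := mu) _ mF) => p.
  by rewrite lee_fin.
- by move=> x; rewrite -lee_fin markov_opE// ge0_int_EFin.
- by exists M; exact: markov_op_le_cst.
Qed.

Lemma bounded_nneg_iter f n : bounded_nneg_mfun f ->
  bounded_nneg_mfun (iter n P f).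
Proof. by move=> bf; elim: n => //= n; exact: bounded_nneg_markov_op. Qed.

Lemma markov_op_cst (c : R) x : P (cst c) x = c.
Proof. by rewrite /P int_prob_cst. Qed.

Lemma markov_opD f h x : bounded_nneg_mfun f -> bounded_nneg_mfun h ->
  P (fun y => f y + h y) x = P f x + P h x.
Proof.
move=> bf bh; apply: EFin_inj; rewrite EFinD !markov_opE//.
  by rewrite int_EFinD//; exact: bounded_nneg_act.
exact: bounded_nneg_add.
Qed.

Lemma markov_opZ (c : R) f x : 0 <= c -> bounded_nneg_mfun f ->
  P (fun y => c * f y) x = c * P f x.
Proof.
move=> c0 bf; apply: EFin_inj; rewrite EFinM !markov_opE//.
  by rewrite int_EFinZ//; exact: bounded_nneg_act.
by apply: bounded_nneg_mul => //; exact: bounded_nneg_cst.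
Qed.

Lemma le_markov_op f h : bounded_nneg_mfun f -> bounded_nneg_mfun h ->
  (forall x, f x <= h x) -> forall x, P f x <= P h x.
Proof.
move=> bf bh fh x; rewrite -lee_fin !markov_opE//.
by apply: le_int_EFin => //; exact: bounded_nneg_act.
Qed.

(** Jensen's inequality for the square: integrate the tangent line inequality
    [2 t s <= s ^+ 2 + t ^+ 2] at [t = P f x]. *)
Lemma markov_op_sqr f x : bounded_nneg_mfun f ->
  P f x ^+ 2 <= P (fun y => f y ^+ 2) x.
Proof.
move=> bf; set t := P f x; have bf2 := bounded_nneg_sqr bf.
have t0 : 0 <= t by have [_ + _] := bounded_nneg_markov_op bf; exact.
have bt : bounded_nneg_mfun (cst (t ^+ 2) : T -> R).
  by apply: bounded_nneg_cst; rewrite sqr_ge0.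
have t20 : 0 <= 2 * t by rewrite mulr_ge0.
have b2tf : bounded_nneg_mfun (fun y => 2 * t * f y).
  by apply: bounded_nneg_mul => //; exact: bounded_nneg_cst.
have : P (fun y => 2 * t * f y) x <= P (fun y => f y ^+ 2 + t ^+ 2) x.
  apply: le_markov_op => //; first exact: bounded_nneg_add.
  by move=> y; have := sqr_ge0 (f y - t); nra.
rewrite markov_opZ// markov_opD// markov_op_cst -/t; nra.
Qed.

(** Jensen's inequality for the convex function [s |-> max 0 (s - e)]. *)
Lemma markov_op_max0B h (e : R) x : 0 <= e -> bounded_nneg_mfun h ->
  Num.max 0 (P h x - e) <= P (fun y => Num.max 0 (h y - e)) x.
Proof.
move=> e0 bh; have be := @bounded_nneg_cst _ T _ _ e0.
have bp := bounded_nneg_max0B bh be.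
have [_ pos _] := bounded_nneg_markov_op bp.
rewrite ge_max pos/= lerBlDr.
rewrite -[X in _ <= _ + X](markov_op_cst e x) -markov_opD//.
apply: le_markov_op => //; first exact: bounded_nneg_add.
by move=> y /=; rewrite -lerBlDr le_max lexx orbT.
Qed.

Lemma markov_op0 f x : bounded_nneg_mfun f -> P f x = 0 ->
  {ae mu, forall g, f (act g x) = 0}.
Proof.
move=> bf Pf0; apply: int0_ae_eq0; first exact: bounded_nneg_act.
by rewrite -markov_opE// Pf0.
Qed.

End markov_operator.

(** * The maximal inequality *)

Section maximal_inequality.
Context {dG dT} {G : measurableType dG} {T : measurableType dT} {R : realType}.
Variables (act : G -> T -> T) (mu : probability G R).
Hypothesis mact : measurable_fun setT (fun p : G * T => act p.1 p.2).
Variable la : {measure set T -> \bar R}.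
Implicit Types f h : T -> R.

Local Notation P := (markov_op act mu).

Definition birkhoff_sum f n (x : T) : R := \sum_(i < n) iter i P f x.

Local Notation S := birkhoff_sum.

Lemma bounded_nneg_birkhoff_sum f n :
  bounded_nneg_mfun f -> bounded_nneg_mfun (S f n).
Proof.
move=> bf; elim: n => [|n IH].
  have -> : S f 0 = cst 0 by apply/funext => x; rewrite /S big_ord0.
  exact: bounded_nneg_cst.
have -> : S f n.+1 = (fun x => S f n x + iter n P f x).
  by apply/funext => x; rewrite /S big_ord_recr.
by apply: bounded_nneg_add => //; exact: bounded_nneg_iter.
Qed.

Lemma birkhoff_sumS f n x : bounded_nneg_mfun f ->
  S f n.+1 x = f x + P (S f n) x.
Proof.
move=> bf; rewrite [LHS]/S big_ord_recl/=; congr (_ + _).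
elim: n x => [|n IH] x.
  rewrite big_ord0 (_ : S f 0 = cst 0) ?markov_op_cst//.
  by apply/funext => y; rewrite /S big_ord0.
rewrite big_ord_recr/= IH.
have -> : S f n.+1 = (fun y => S f n y + iter n P f y).
  by apply/funext => y; rewrite /S big_ord_recr.
rewrite (markov_opD mu mact)//; last exact: bounded_nneg_iter.
exact: bounded_nneg_birkhoff_sum.
Qed.

Lemma birkhoff_sum_le f (M : R) n x : bounded_nneg_mfun f ->
  (forall y, f y <= M) -> S f n x <= M * n%:R.
Proof.
move=> bf fM; rewrite /S.
have fMn i : forall y, iter i P f y <= M.
  elim: i => //= i IH y; apply: (markov_op_le_cst mu mact) => //.
  exact: bounded_nneg_iter.
apply: (@le_trans _ _ (\sum_(i < n) M)); first by apply: ler_sum => i _.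
by rewrite sumr_const card_ord mulr_natr.
Qed.

(** The value of the optimal stopping problem of horizon [n] with running reward
    [f - a], computed by dynamic programming. It dominates the excesses
    [S f k x - a * k] for [k <= n], and its recursive definition makes the
    maximal inequality a telescoping of integrals. *)
Fixpoint max_excess f (a : R) n : T -> R :=
  if n is m.+1 then
    fun x => Num.max 0 (f x + P (max_excess f a m) x - a)
  else cst 0.

Lemma bounded_nneg_max_excess f (a : R) n : 0 <= a ->
  bounded_nneg_mfun f -> bounded_nneg_mfun (max_excess f a n).
Proof.
move=> a0 bf; elim: n => [|n IH] /=; first exact: bounded_nneg_cst.
apply: (@bounded_nneg_max0B _ _ _ (fun x => f x + P (max_excess f a n) x)).
  by apply: bounded_nneg_add => //; exact: bounded_nneg_markov_op.
exact: bounded_nneg_cst.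
Qed.

Lemma max_excess_le f (a : R) n x : 0 <= a -> bounded_nneg_mfun f ->
  max_excess f a n x <= max_excess f a n.+1 x.
Proof.
move=> a0 bf; elim: n x => [|n IH] x; first by rewrite /= le_max lexx.
rewrite [leLHS]/= [leRHS]/= ge_max le_max lexx/= le_max.
rewrite lerB// ?orbT// lerD//.
apply: (le_markov_op mu mact _ (bounded_nneg_max_excess n.+1 a0 bf)) => //.
exact: bounded_nneg_max_excess.
Qed.

Lemma birkhoff_sum_max_excess f (a : R) n x : 0 <= a -> bounded_nneg_mfun f ->
  S f n x <= max_excess f a n x + a * n%:R.
Proof.
move=> a0 bf; elim: n x => [|n IH] x.
  by rewrite /S big_ord0 mulr0 addr0.
have bM := bounded_nneg_max_excess n a0 bf.
have ban : bounded_nneg_mfun (cst (a * n%:R) : T -> R).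
  by apply: bounded_nneg_cst; rewrite mulr_ge0.
have SM : P (S f n) x <= P (max_excess f a n) x + a * n%:R.
  rewrite -[X in _ <= _ + X](markov_op_cst act mu (a * n%:R) x).
  rewrite -markov_opD//; apply: le_markov_op => //.
    exact: bounded_nneg_birkhoff_sum.
  exact: bounded_nneg_add.
rewrite birkhoff_sumS//= -[leLHS](subrK (a * n.+1%:R)) lerD2r le_max.
by apply/orP; right; rewrite -natr1 mulrDr mulr1; lra.
Qed.

Hypothesis rev : forall f h, bounded_nneg_mfun f -> bounded_nneg_mfun h ->
  (\int[la]_x (P f x * h x)%:E = \int[la]_x (f x * P h x)%:E)%E.

Lemma int_markov_op f : bounded_nneg_mfun f ->
  (\int[la]_x (P f x)%:E = \int[la]_x (f x)%:E)%E.
Proof.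
move=> bf; have := rev bf (@bounded_nneg_cst _ T R 1 ler01).
under eq_integral do rewrite mulr1.
by under [in RHS]eq_integral do rewrite markov_op_cst mulr1.
Qed.

Lemma int_max_excess_fin f (a : R) n : 0 <= a -> bounded_nneg_mfun f ->
  (\int[la]_x (f x)%:E < +oo)%E ->
  (\int[la]_x (max_excess f a n x)%:E < +oo)%E.
Proof.
move=> a0 bf foo; elim: n => [|n IH]; first by rewrite integral0.
have bM := bounded_nneg_max_excess n a0 bf.
have bPM := bounded_nneg_markov_op mu mact bM.
apply: (@le_lt_trans _ _
  (\int[la]_x (f x + P (max_excess f a n) x)%:E)%E).
  apply: le_int_EFin.
  - exact: (bounded_nneg_max_excess n.+1).
  - exact: bounded_nneg_add.
  - move=> x /=; have [_ f0 _] := bf; have [_ PM0 _] := bPM.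
    by rewrite ge_max; apply/andP; split; [rewrite addr_ge0|rewrite gerBl].
by rewrite int_EFinD// lte_add_pinfty// int_markov_op.
Qed.

(** On the set where it is positive, [max_excess f a n.+1] is
    [f - a + P (max_excess f a n)]. Integrate: [P] preserves integrals and
    [max_excess f a] is nondecreasing in [n], so only [f - a] is left. *)
Lemma max_excess_superlevel f (a : R) n : 0 <= a -> bounded_nneg_mfun f ->
  (\int[la]_x (f x)%:E < +oo)%E ->
  (a%:E * la [set x | (0 < max_excess f a n.+1 x)%R]
     <= \int[la]_x (f x)%:E)%E.
Proof.
move=> a0 bf foo; set B := [set x | _]; pose M := max_excess f a.
have bM k : bounded_nneg_mfun (M k) by exact: bounded_nneg_max_excess.
have bPM := bounded_nneg_markov_op mu mact (bM n).
have mB : measurable B by apply: measurable_superlevel; case: (bM n.+1).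
have b1 := bounded_nneg_indic (R := R) mB.
have ba1 : bounded_nneg_mfun (fun x => a * \1_B x).
  by apply: bounded_nneg_mul => //; exact: bounded_nneg_cst.
have Mfin : (\int[la]_x (M n.+1 x)%:E)%E \is a fin_num.
  rewrite ge0_fin_numE; first exact: int_max_excess_fin.
  by apply: ge0_int_EFin; case: (bM n.+1).
rewrite -[X in la X]setIT -integral_indic// -int_EFinZ//.
rewrite -(leeD2rE _ _ Mfin) -int_EFinD//.
apply: (@le_trans _ _ (\int[la]_x (f x + P (M n) x)%:E)%E).
  apply: le_int_EFin; [exact: bounded_nneg_add|exact: bounded_nneg_add|].
  move=> x; rewrite indicE; have [_ f0 _] := bf; have [_ PM0 _] := bPM.
  have := f0 x; have := PM0 x.
  have ME : M n.+1 x = Num.max 0 (f x + P (M n) x - a) by [].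
  have [Mpos|Mneg] := ltP 0 (M n.+1 x).
    rewrite mem_set//= mulr1; move: Mpos; rewrite ME lt_max ltxx/=.
    by move=> /ltW /max_idPr ->; lra.
  rewrite memNset; last by apply/negP; rewrite -leNgt.
  by move=> *; rewrite mulr0 add0r (le_trans Mneg)// addr_ge0.
rewrite int_EFinD// int_markov_op// leeD2l//.
apply: le_int_EFin => // x; exact: max_excess_le.
Qed.

(** Hopf's maximal inequality: the sets where [max_excess f a n] is positive
    increase with [n] and have uniformly bounded measures. *)
Lemma birkhoff_sum_maximal f (a : R) : 0 < a -> bounded_nneg_mfun f ->
  (\int[la]_x (f x)%:E < +oo)%E ->
  (la [set x | exists n, (a * n%:R < S f n x)%R] < +oo)%E.
Proof.
move=> a0 bf foo; pose F n := [set x | (0 < max_excess f a n.+1 x)%R].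
have bM k : bounded_nneg_mfun (max_excess f a k).
  by apply: bounded_nneg_max_excess => //; exact: ltW.
have mF n : measurable (F n) by apply: measurable_superlevel; case: (bM n.+1).
have mUF : measurable (\bigcup_n F n) by exact: bigcup_measurable.
have UFoo : (la (\bigcup_n F n) < +oo)%E.
  have ndF : nondecreasing_seq F.
    apply/nondecreasing_seqP => n; apply/subsetPset => x /lt_le_trans; apply.
    exact: (max_excess_le _ _ (ltW a0) bf).
  have cF : (la \o F) n @[n --> \oo] --> la (\bigcup_n F n).
    exact: nondecreasing_cvg_mu.
  have : (la (\bigcup_n F n) <= a^-1%:E * \int[la]_x (f x)%:E)%E.
    rewrite -(cvg_lim _ cF)//; apply: lime_le; first exact: cvgP cF.
    apply: nearW => n /=.
    have := max_excess_superlevel n (ltW a0) bf foo.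
    by rewrite -(@lee_pmul2l _ a^-1%:E) ?lte_fin ?invr_gt0//
      muleA -EFinM mulVf ?gt_eqF// mul1e.
  move=> /le_lt_trans; apply.
  by rewrite lte_mul_pinfty// ?lee_fin ?invr_ge0 ?ltW.
apply: le_lt_trans UFoo; apply: le_measure; rewrite ?inE//.
  have -> : [set x | exists n, a * n%:R < S f n x] =
      \bigcup_n [set x | a * n%:R < S f n x].
    by apply/seteqP; split => x [n]; [exists n|exists n].
  apply: bigcup_measurable => n _; apply: measurable_superlevel.
  by case: (bounded_nneg_birkhoff_sum n bf).
move=> x [n Sn]; exists n => //; rewrite /F/=.
rewrite (lt_le_trans _ (max_excess_le n x (ltW a0) bf))//.
by have := birkhoff_sum_max_excess n x (ltW a0) bf; move: Sn; lra.
Qed.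

(** The positive part [phi] of [h - e] is subharmonic by Jensen's inequality
    and integrable, and [P] preserves integrals, so [phi] is harmonic almost
    everywhere. A harmonic nonnegative function vanishing at [x] vanishes at
    almost every neighbour of [x]. *)
Lemma subharmonic_superlevel h (e : R) : 0 <= e -> bounded_nneg_mfun h ->
  (forall x, h x <= P h x) -> (la [set x | (e < h x)%R] < +oo)%E ->
  {ae la, forall x, P (\1_[set y | e < h y]) x <= \1_[set y | e < h y] x}.
Proof.
move=> e0 bh hPh; set E := [set x | _] => Eoo.
have mE : measurable E by apply: measurable_superlevel; case: bh.
have b1 := bounded_nneg_indic (R := R) mE.
pose phi y := Num.max 0 (h y - e).
have bphi : bounded_nneg_mfun phi.
  by apply: bounded_nneg_max0B => //; exact: (@bounded_nneg_cst _ T R e).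
have phiP x : phi x <= P phi x.
  apply: (le_trans _ (markov_op_max0B mu mact x e0 bh)).
  by rewrite ge_max le_max lexx/= le_max lerB// orbT.
have phioo : (\int[la]_x (phi x)%:E < +oo)%E.
  have [_ phi0 [M' phiM']] := bphi.
  pose M := Num.max 0 M'; have M0 : 0 <= M by rewrite le_max lexx.
  have phiM x : phi x <= M by rewrite le_max phiM' orbT.
  apply: (@le_lt_trans _ _ (\int[la]_x (M * \1_E x)%:E)%E).
    apply: le_int_EFin => //.
      by apply: bounded_nneg_mul => //; exact: bounded_nneg_cst.
    move=> x; rewrite indicE; case: (boolP (x \in E)) => xE.
      by rewrite mulr1.
    rewrite mulr0 /phi ge_max lexx/= subr_le0 leNgt.
    by apply/negP => ?; move/negP: xE; apply; rewrite inE.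
  rewrite int_EFinZ// integral_indic// setIT lte_mul_pinfty//.
have bPphi := bounded_nneg_markov_op mu mact bphi.
have := ae_eq_of_le_int bphi bPphi phiP (int_markov_op bphi) phioo.
apply: filterS => x Pphix.
have le1 : P \1_E x <= 1.
  by apply: (markov_op_le_cst mu mact) => // y; rewrite indicE; case: (_ \in _).
rewrite [leRHS]indicE; case: (boolP (x \in E)) => xE; first exact: le1.
have phix0 : phi x = 0.
  apply/max_idPl; rewrite subr_le0 leNgt.
  by apply/negP => ?; move/negP: xE; apply; rewrite inE.
have := markov_op0 mact bphi (etrans Pphix phix0) => ae0.
rewrite -lee_fin markov_opE//.
rewrite (@ae_eq_integral _ _ _ mu setT (cst 0%E))//= ?integral0//.
- by apply: bounded_nneg_EFin; exact: (bounded_nneg_act mact x).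
- move: ae0; apply: filterS => g phig _; rewrite indicE/=.
  case: (boolP (_ \in E)) => //; rewrite inE /E/= => eh; move: phig.
  by rewrite /phi => /max_idPl; rewrite subr_le0 leNgt eh.
Qed.

End maximal_inequality.

(** * Square functions *)

(** A Tauberian lemma. For [n <= m < 2 n] the increments between the times [n]
    and [m] are bounded by [|d| <= s / 2 + d ^+ 2 / (2 s)] with [s = e / n]:
    the constants add up to at most [e / 2], and the squares to at most
    [(2 e)^-1] times the tail of the series at [n]. So [w n] exceeds by at most
    [e] its average over [n, 2 n), which is at most twice the Cesaro mean at
    time [2 n]. *)
Lemma cvg0_of_cesaro {R : realType} (w : nat -> R) : (forall n, 0 <= w n) ->
  (\sum_(k <oo) (k.+1%:R * (w k.+1 - w k) ^+ 2)%:E < +oo)%E ->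
  (forall e : R, 0 < e -> \forall n \near \oo, \sum_(k < n) w k <= e * n%:R) ->
  forall e : R, 0 < e -> \forall n \near \oo, w n <= e.
Proof.
move=> w0 sumoo cesaro e' e'0.
pose a k := k.+1%:R * (w k.+1 - w k) ^+ 2.
have a0 k : 0 <= a k by rewrite mulr_ge0// sqr_ge0.
(* the increments cost [e], the average over [n, 2 n) costs [2 e] *)
pose e := e' / 3; have e0 : 0 < e by rewrite divr_gt0.
have tail : \forall n \near \oo, (\sum_(n <= k <oo) (a k)%:E < (e ^+ 2)%:E)%E.
  have := @nneseries_tail_cvg R (EFin \o a) xpredT sumoo (fun k _ => a0 k).
  move=> /(_ [set x | (x < (e ^+ 2)%:E)%E]); apply.
  apply: open_nbhs_nbhs; split; first exact: open_ereal_lt_ereal.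
  by rewrite /= lte_fin exprn_gt0.
have [N _ hN] := cesaro _ e0.
near=> n.
have n1 : (0 < n)%N by near: n; exact: nbhs_infty_gt.
have nN : (N <= n)%N by near: n; exact: nbhs_infty_ge.
have tn : (\sum_(n <= k <oo) (a k)%:E < (e ^+ 2)%:E)%E by near: n.
have nR : 0 < n%:R :> R by rewrite ltr0n.
have sumtail m : \sum_(n <= k < m) a k <= e ^+ 2.
  rewrite -lee_fin -sumEFin (le_trans _ (ltW tn))//.
  by apply: nneseries_lim_ge => k _ _; rewrite lee_fin.
have step m : (m <= n)%N -> w n <= w (n + m)%N + m%:R * (e / (2 * n%:R)) +
    \sum_(n <= k < n + m) a k / (2 * e).
  elim: m => [|m IH] mn.
    by rewrite addn0 big_geq// mul0r !addr0.
  apply: (le_trans (IH (ltnW mn))).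
  rewrite addnS big_nat_recr/= ?leq_addr//.
  set d := w (n + m).+1 - w (n + m)%N.
  have dm : n%:R * d ^+ 2 <= a (n + m)%N.
    by rewrite ler_wpM2r ?sqr_ge0// ler_nat leqW// leq_addr.
  suff : - d <= e / (2 * n%:R) + a (n + m)%N / (2 * e).
    by rewrite -natr1 /d; lra.
  apply: (@le_trans _ _ (e / (2 * n%:R) + n%:R * d ^+ 2 / (2 * e))); last first.
    by rewrite lerD2l ler_pM2r// invr_gt0 mulr_gt0.
  have -> : e / (2 * n%:R) + n%:R * d ^+ 2 / (2 * e) =
      (e ^+ 2 + (n%:R * d) ^+ 2) / (2 * n%:R * e).
    by field; rewrite !gt_eqF.
  rewrite ler_pdivlMr ?mulr_gt0//.
  by have := sqr_ge0 (e + n%:R * d); nra.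
have wm m : (m < n)%N -> w n <= w (n + m)%N + e.
  move=> mn; apply: (le_trans (step m (ltnW mn))).
  rewrite -addrA lerD2l.
  have h1 : m%:R * (e / (2 * n%:R)) <= e / 2.
    rewrite [leLHS](_ : _ = (e / 2) * (m%:R / n%:R)); last first.
      by field; rewrite gt_eqF.
    apply: ler_piMr; first by rewrite divr_ge0// ltW.
    by rewrite ler_pdivrMr// mul1r ler_nat ltnW.
  have h2 : \sum_(n <= k < n + m) a k / (2 * e) <= e / 2.
    rewrite -mulr_suml ler_pdivrMr ?mulr_gt0// (le_trans (sumtail _))//.
    by rewrite (_ : e / 2 * (2 * e) = e ^+ 2)//; field.
  lra.
have nw : n%:R * w n <= \sum_(m < n) w (n + m)%N + n%:R * e.
  apply: (@le_trans _ _ (\sum_(m < n) (w (n + m)%N + e))).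
    rewrite mulr_natl -[n in _ *+ n]card_ord -sumr_const.
    by apply: ler_sum => m _; exact: wm.
  by rewrite big_split/= sumr_const card_ord mulr_natl.
have s2n : \sum_(m < n) w (n + m)%N <= e * (n + n)%:R.
  apply: (le_trans _ (hN (n + n)%N _)); last first.
    by rewrite /= (leq_trans nN)// leq_addr.
  by rewrite big_split_ord/= lerDr sumr_ge0.
rewrite natrD in s2n.
have : n%:R * w n <= n%:R * e'.
  by have -> : e' = 3 * e; [rewrite /e; field|lra].
by rewrite ler_pM2l.
Unshelve. all: by end_near. Qed.

Section square_function.
Context {dG dT} {G : measurableType dG} {T : measurableType dT} {R : realType}.
Variables (act : G -> T -> T) (mu : probability G R).
Hypothesis mact : measurable_fun setT (fun p : G * T => act p.1 p.2).
Variable la : {measure set T -> \bar R}.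
Implicit Types f h : T -> R.

Local Notation P := (markov_op act mu).

Hypothesis rev : forall f h, bounded_nneg_mfun f -> bounded_nneg_mfun h ->
  (\int[la]_x (P f x * h x)%:E = \int[la]_x (f x * P h x)%:E)%E.

Definition sqr_norm f : R := fine (\int[la]_x (f x ^+ 2)%:E).

Lemma int_sqr_fin f : bounded_nneg_mfun f -> (\int[la]_x (f x)%:E < +oo)%E ->
  (\int[la]_x (f x ^+ 2)%:E < +oo)%E.
Proof.
move=> bf foo; have [_ f0 [M fM]] := bf.
pose M' := Num.max 0 M; have M0 : 0 <= M' by rewrite le_max lexx.
apply: (@le_lt_trans _ _ (\int[la]_x (M' * f x)%:E)%E).
  apply: le_int_EFin; first exact: bounded_nneg_sqr.
    by apply: bounded_nneg_mul => //; exact: bounded_nneg_cst.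
  by move=> x; rewrite expr2 ler_wpM2r// le_max fM orbT.
by rewrite int_EFinZ// lte_mul_pinfty.
Qed.

Lemma sqr_normE f : bounded_nneg_mfun f -> (\int[la]_x (f x)%:E < +oo)%E ->
  ((sqr_norm f)%:E = \int[la]_x (f x ^+ 2)%:E)%E.
Proof.
move=> bf foo; rewrite fineK// ge0_fin_numE ?int_sqr_fin//.
by apply: ge0_int_EFin => x; rewrite sqr_ge0.
Qed.

Lemma int_iter_fin f n : bounded_nneg_mfun f -> (\int[la]_x (f x)%:E < +oo)%E ->
  (\int[la]_x (iter n P f x)%:E < +oo)%E.
Proof.
move=> bf foo; elim: n => //= n IH; rewrite int_markov_op//.
exact: bounded_nneg_iter.
Qed.

Lemma sqr_norm_markov_op f : bounded_nneg_mfun f ->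
  (\int[la]_x (f x)%:E < +oo)%E -> sqr_norm (P f) <= sqr_norm f.
Proof.
move=> bf foo; have bP := bounded_nneg_markov_op mu mact bf.
rewrite -lee_fin !sqr_normE// ?int_markov_op//.
rewrite -(int_markov_op rev (bounded_nneg_sqr bf)).
apply: le_int_EFin; first exact: bounded_nneg_sqr.
  by apply: bounded_nneg_markov_op => //; exact: bounded_nneg_sqr.
by move=> x; exact: markov_op_sqr.
Qed.

(** Reversibility turns the scalar product of [f] and [P (P f)] into the square
    norm of [P f], so that the left-hand side is a second difference of the
    sequence of the square norms of the iterates. *)
Lemma int_sqr_second_diff f : bounded_nneg_mfun f ->
  (\int[la]_x (f x)%:E < +oo)%E ->
  (\int[la]_x ((P (P f) x - f x) ^+ 2)%:E =
   (sqr_norm (P (P f)) - 2 * sqr_norm (P f) + sqr_norm f)%:E)%E.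
Proof.
move=> bf foo; have bP := bounded_nneg_markov_op mu mact bf.
have bPP := bounded_nneg_markov_op mu mact bP.
have bm := bounded_nneg_mul bPP bf.
have bd := bounded_nneg_sqr_diff bPP bf.
have cross : (\int[la]_x (P (P f) x * f x)%:E = (sqr_norm (P f))%:E)%E.
  rewrite rev// sqr_normE// ?int_markov_op//.
have two : (0 <= 2 :> R) by [].
have : (\int[la]_x ((P (P f) x - f x) ^+ 2)%:E + (2 * sqr_norm (P f))%:E =
    (sqr_norm (P (P f)))%:E + (sqr_norm f)%:E)%E.
  rewrite EFinM -cross -int_EFinZ// -int_EFinD//; last first.
    by apply: bounded_nneg_mul => //; exact: bounded_nneg_cst.
  rewrite !sqr_normE ?int_markov_op// -int_EFinD; try exact: bounded_nneg_sqr.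
  by apply: eq_integral => x _; congr EFin; ring.
move: (\int[la]_x ((P (P f) x - f x) ^+ 2)%:E)%E => [r| |]//=.
by rewrite -!EFinD => -[?]; congr EFin; lra.
Qed.

(** The Littlewood-Paley square function is integrable. With [c j] the square
    norm of [P^j f] and [q k] the integral of the [k]-th squared increment,
    [q k] is the second difference of [c] at [2 k], and the first differences
    [c j - c j.+1] are nonnegative and nonincreasing: an Abel summation
    bounds the partial sums of [k.+1 * q k] by [c 0]. *)
Lemma square_function_fin f : bounded_nneg_mfun f ->
  (\int[la]_x (f x)%:E < +oo)%E ->
  {ae la, forall x, (\sum_(k <oo)
    (k.+1%:R * (iter k.+1.*2 P f x - iter k.*2 P f x) ^+ 2)%:E < +oo)%E}.
Proof.
move=> bf foo.
have bi n := bounded_nneg_iter mu mact n bf.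
have ioo n := int_iter_fin n bf foo.
pose c j := sqr_norm (iter j P f).
pose q k := c k.*2.+2 - 2 * c k.*2.+1 + c k.*2.
have c0 j : 0 <= c j.
  by apply/fine_ge0/ge0_int_EFin => x; exact: sqr_ge0.
have cdec j : c j.+1 <= c j by exact: (sqr_norm_markov_op (bi j) (ioo j)).
have cconv j : 0 <= c j.+2 - 2 * c j.+1 + c j.
  have E := int_sqr_second_diff (bi j) (ioo j).
  rewrite -lee_fin -[leRHS]E.
  by apply: ge0_int_EFin => x; exact: sqr_ge0.
pose a k x := k.+1%:R * (iter k.+1.*2 P f x - iter k.*2 P f x) ^+ 2.
have bd k : bounded_nneg_mfun
    (fun x => (iter k.+1.*2 P f x - iter k.*2 P f x) ^+ 2).
  exact: bounded_nneg_sqr_diff.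
have ba k : bounded_nneg_mfun (a k).
  by apply: bounded_nneg_mul => //; exact: bounded_nneg_cst.
have inta k : (\int[la]_x (a k x)%:E = (k.+1%:R * q k)%:E)%E.
  rewrite int_EFinZ// EFinM; congr (_ * _)%E.
  exact: (int_sqr_second_diff (bi k.*2) (ioo k.*2)).
have abel n : \sum_(k < n) k.+1%:R * q k + n%:R * (c n.*2 - c n.*2.+1) + c n.*2
    <= c 0.
  elim: n => [|n IH]; first by rewrite big_ord0 mul0r !add0r double0.
  apply: le_trans IH; rewrite big_ord_recr/= doubleS -natr1 /q.
  have := cconv n.*2; have := cconv n.*2.+1; have := cdec n.*2.+2.
  have := cdec n.*2.+1.
  have : 0 <= n%:R :> R by [].
  set x0 := c n.*2; set x1 := c n.*2.+1; set x2 := c n.*2.+2.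
  set x3 := c n.*2.+3; set s := \sum_(_ < _) _; move: (n%:R : R) => N.
  nra.
have : (\int[la]_x (\sum_(k <oo) (a k x)%:E) < +oo)%E.
  rewrite integral_nneseries//; last 2 first.
    by move=> k; exact: bounded_nneg_EFin.
    by move=> k x _; rewrite lee_fin; case: (ba k).
  apply: (@le_lt_trans _ _ (c 0)%:E); last exact: ltry.
  apply: lime_le.
    apply: is_cvg_nneseries => n _ _; apply: ge0_int_EFin.
    by case: (ba n).
  apply: nearW => n; rewrite big_mkord.
  under eq_bigr do rewrite inta.
  rewrite sumEFin lee_fin (le_trans _ (abel n))//.
  by rewrite -addrA lerDl addr_ge0// mulr_ge0// subr_ge0.
move=> intoo.
have mS : measurable_fun setT (fun x => \sum_(k <oo) (a k x)%:E)%E.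
  apply: ge0_emeasurable_sum => k.
    by move=> x _ _; rewrite lee_fin; case: (ba k).
  by move=> _; exact: bounded_nneg_EFin.
have S0 x : (0 <= \sum_(k <oo) (a k x)%:E)%E.
  by apply: nneseries_ge0 => k _ _; rewrite lee_fin; case: (ba k).
have iS : la.-integrable setT (fun x => \sum_(k <oo) (a k x)%:E)%E.
  apply/integrableP; split=> //.
  by under eq_integral do rewrite gee0_abs//.
have := integrable_ae measurableT iS.
by apply: filterS => x /(_ I); rewrite ge0_fin_numE.
Qed.

End square_function.

(** * Almost everywhere convergence of the iterates *)

Section dissipation.
Context {dG dT} {G : measurableType dG} {T : measurableType dT} {R : realType}.
Variables (act : G -> T -> T) (mu : probability G R).
Hypothesis mact : measurable_fun setT (fun p : G * T => act p.1 p.2).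
Variable la : {measure set T -> \bar R}.
Implicit Types f h : T -> R.

Local Notation P := (markov_op act mu).
Local Notation S := (birkhoff_sum act mu).

Hypothesis rev : forall f h, bounded_nneg_mfun f -> bounded_nneg_mfun h ->
  (\int[la]_x (P f x * h x)%:E = \int[la]_x (f x * P h x)%:E)%E.

Hypothesis no_invariant : forall E : set T, measurable E -> (la E < +oo)%E ->
  {ae la, forall x, P (\1_E) x <= \1_E x} -> la E = 0%E.

(** The index is shifted to average over [n.+1] times, never over none. *)
Definition birkhoff_avg f n x := S f n.+1 x / n.+1%:R.
Local Notation A := birkhoff_avg.

Section limsup.
Variable f : T -> R.
Hypotheses (bf : bounded_nneg_mfun f) (f1 : forall x, f x <= 1).

Lemma birkhoff_avg_bound n x : 0 <= A f n x <= 1.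
Proof.
have [_ S0 _] := bounded_nneg_birkhoff_sum mu mact n.+1 bf.
rewrite divr_ge0//= ler_pdivrMr ?ltr0n// .
by apply: (birkhoff_sum_le mu mact).
Qed.

Lemma bounded_nneg_birkhoff_avg n : bounded_nneg_mfun (A f n).
Proof.
have -> : A f n = (fun x => n.+1%:R^-1 * S f n.+1 x).
  by apply/funext => x; rewrite /A mulrC.
apply: bounded_nneg_mul; first by apply: bounded_nneg_cst; rewrite invr_ge0.
exact: bounded_nneg_birkhoff_sum.
Qed.

Let H x : \bar R := limn_esup (fun n => (A f n x)%:E).

Let H_bound x : (0 <= H x <= 1)%E.
Proof.
have A01 n := birkhoff_avg_bound n x.
rewrite /H limn_esup_lim; apply/andP; split.
- apply: lime_ge; first exact: is_cvg_esups.
  apply: nearW => n; apply: (@le_trans _ _ (A f n x)%:E).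
    by rewrite lee_fin; case/andP: (A01 n).
  by apply: ereal_sup_ubound; exists n => /=.
- apply: lime_le; first exact: is_cvg_esups.
  apply: nearW => n; apply: ge_ereal_sup => _ [m _ <-].
  by rewrite lee_fin; case/andP: (A01 m).
Qed.

Definition limsup_avg x : R := fine (H x).

Lemma limsup_avgE x : ((limsup_avg x)%:E = limn_esup (fun n => (A f n x)%:E))%E.
Proof.
rewrite fineK//; have /andP[H0 H1] := H_bound x.
by rewrite ge0_fin_numE// (le_lt_trans H1)// ltry.
Qed.

Lemma limsup_avg_bound x : 0 <= limsup_avg x <= 1.
Proof. by rewrite -!lee_fin limsup_avgE; exact: H_bound. Qed.

Lemma bounded_nneg_limsup_avg : bounded_nneg_mfun limsup_avg.
Proof.
split; last by exists 1 => x; case/andP: (limsup_avg_bound x).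
  apply: (@measurableT_comp _ _ _ _ _ _ (@fine R)) => //.
  apply: measurable_fun_limn_esup => n.
  exact/bounded_nneg_EFin/bounded_nneg_birkhoff_avg.
by move=> x; case/andP: (limsup_avg_bound x).
Qed.

Lemma limsup_avg_lt x (e : R) : limsup_avg x < e ->
  \forall n \near \oo, A f n x <= e.
Proof.
rewrite -lte_fin limsup_avgE limn_esup_lim => lt_e.
have [N HN] : exists N, (esups (fun n => (A f n x)%:E) N < e%:E)%E.
  apply: contrapT => /forallNP He; move: lt_e; apply/negP; rewrite -leNgt.
  apply: lime_ge; first exact: is_cvg_esups.
  by apply: nearW => n; rewrite leNgt; exact/negP.
exists N => // n /= Nn; rewrite -lee_fin (le_trans _ (ltW HN))//.
by apply: ereal_sup_ubound; exists n.
Qed.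

(** Fatou's lemma applied to [1 - A f n] at almost invariant averages: the
    defect of invariance of [A f n] is at most [1 / (n + 1)]. *)
Lemma limsup_avg_subharmonic x : limsup_avg x <= P limsup_avg x.
Proof.
have bA := bounded_nneg_birkhoff_avg.
have bh := bounded_nneg_limsup_avg.
have b1 : bounded_nneg_mfun (cst 1 : T -> R) by exact: bounded_nneg_cst.
pose c n y := Num.max 0 (1 - A f n y).
have bc n : bounded_nneg_mfun (c n) by exact: (bounded_nneg_max0B b1 (bA n)).
have cE n y : c n y = 1 - A f n y.
  by apply/max_idPr; rewrite subr_ge0; case/andP: (birkhoff_avg_bound n y).
pose k y := Num.max 0 (1 - limsup_avg y).
have bk : bounded_nneg_mfun k by exact: (bounded_nneg_max0B b1 bh).
have kE y : k y = 1 - limsup_avg y.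
  by apply/max_idPr; rewrite subr_ge0; case/andP: (limsup_avg_bound y).
have liminfE y : limn_einf (fun n => (c n y)%:E) = (k y)%:E.
  rewrite kE EFinB limsup_avgE -limn_einfN -limn_einf_shift//.
  by congr limn_einf; apply/funext => n /=; rewrite cE EFinB.
have one_split (g h : T -> R) : (forall y, g y + h y = 1) ->
    bounded_nneg_mfun g -> bounded_nneg_mfun h -> P g x + P h x = 1.
  move=> gh bg bh'; rewrite -markov_opD// -[RHS](markov_op_cst act mu 1 x).
  by congr (P _ _); apply/funext => y; rewrite gh.
have Pk : P k x + P limsup_avg x = 1.
  by apply: one_split => // y; rewrite kE subrK.
have Pc n : P (c n) x + P (A f n) x = 1.
  by apply: one_split => // y; rewrite cE subrK.
have PA n : A f n x - n.+1%:R^-1 <= P (A f n) x.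
  have -> : P (A f n) x = n.+1%:R^-1 * P (S f n.+1) x.
    rewrite -markov_opZ//; last exact: bounded_nneg_birkhoff_sum.
    by congr (P _ _); apply/funext => y; rewrite /A mulrC.
  have := birkhoff_sumS mu mact n.+1 x bf.
  have : S f n.+1 x <= S f n.+2 x.
    rewrite [leRHS]/birkhoff_sum big_ord_recr lerDl.
    by case: (bounded_nneg_iter mu mact n.+1 bf).
  move=> le PS; rewrite /A mulrC -[X in _ - X]mulr1 -mulrBr ler_wpM2l//.
  by have := f1 x; lra.
rewrite leNgt; apply/negP => lt_h.
pose e := (limsup_avg x - P limsup_avg x) / 2.
have e0 : 0 < e by rewrite /e; lra.
have : (\int[mu]_g limn_einf (fun n => (c n (act g x))%:E) <=
    limn_einf (fun n => \int[mu]_g (c n (act g x))%:E))%E.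
  apply: (fatou _ _ (f := fun n g => (c n (act g x))%:E)) => //.
    by move=> n; apply: bounded_nneg_EFin; exact: (bounded_nneg_act mact x).
  by move=> n g _; rewrite lee_fin; case: (bc n).
under eq_integral do rewrite liminfE.
rewrite -markov_opE// => Fatou.
have : ((P k x)%:E <= limn_einf (fun n => (e + c n x)%:E))%E.
  apply: (le_trans Fatou); rewrite !limn_einf_lim; apply: lee_lim.
  - exact: is_cvg_einfs.
  - exact: is_cvg_einfs.
  near=> n; apply: le_ereal_inf_tmp => _ [m /= nm <-].
  apply: (@le_trans _ _ (\int[mu]_g (c m (act g x))%:E)%E).
    by apply: ereal_inf_lbound; exists m.
  rewrite -markov_opE// lee_fin.
  have me : m.+1%:R^-1 <= e.
    apply: ltW; rewrite invf_plt ?posrE//.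
    have : e^-1 < n%:R by near: n; exact: nbhs_infty_gtr.
    by move=> /lt_le_trans; apply; rewrite ler_nat leqW.
  move: (Pc m) (PA m) me; rewrite cE; move: (_^-1) (P (A f m) x) (P (c m) x).
  by move=> *; lra.
have -> : limn_einf (fun n => (e + c n x)%:E) = (e + k x)%:E.
  by rewrite EFinD -liminfE -limn_einf_shift//.
by rewrite lee_fin kE; move: Pk; rewrite /e; lra.
Unshelve. all: by end_near. Qed.

(** A superlevel set of the upper limit has finite measure by the maximal
    inequality, and is not entered from outside since the upper limit is
    subharmonic. *)
Lemma limsup_avg0 : (\int[la]_x (f x)%:E < +oo)%E ->
  {ae la, forall x, limsup_avg x <= 0}.
Proof.
move=> foo; have bh := bounded_nneg_limsup_avg.
have null (e : R) : 0 < e -> la [set x | (e < limsup_avg x)%R] = 0%E.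
  move=> e0; have mE : measurable [set x | e < limsup_avg x].
    by apply: measurable_superlevel; case: bh.
  have Eoo : (la [set x | (e < limsup_avg x)%R] < +oo)%E.
    apply: le_lt_trans (birkhoff_sum_maximal mact rev e0 bf foo).
    apply: le_measure; rewrite ?inE//.
      have -> : [set x | exists n, e * n%:R < S f n x] =
          \bigcup_n [set x | e * n%:R < S f n x].
        by apply/seteqP; split => x [n]; [exists n|exists n].
      apply: bigcup_measurable => n _; apply: measurable_superlevel.
      by case: (bounded_nneg_birkhoff_sum mu mact n bf).
    move=> x /= lt_e; apply: contrapT => /forallNP Hn.
    move: lt_e; apply/negP; rewrite -leNgt -lee_fin limsup_avgE limn_esup_lim.
    apply: lime_le; first exact: is_cvg_esups.
    apply: nearW => n; apply: ge_ereal_sup => _ [m _ <-].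
    rewrite lee_fin ler_pdivrMr ?ltr0n// leNgt; apply/negP; exact: Hn.
  apply: no_invariant => //.
  exact: (subharmonic_superlevel mact rev (ltW e0) bh
    limsup_avg_subharmonic Eoo).
have : {ae la, forall x, forall k, limsup_avg x <= k.+1%:R^-1}.
  apply/ae_foralln => k; exists [set x | (k.+1%:R^-1 < limsup_avg x)%R].
  split; first by apply: measurable_superlevel; case: bh.
    by apply: null; rewrite invr_gt0.
  by move=> x /= /negP; rewrite -ltNge.
apply: filterS => x hx; rewrite leNgt; apply/negP => pos.
have [k _ /(_ k (leqnn k)) hk] := near_infty_natSinv_lt (PosNum pos).
by have := le_lt_trans (hx k) hk; rewrite /= ltxx.
Qed.

End limsup.

(** Along even times, the squares of the increments of the iterates are summable
    with the weights [k], which by the Tauberian lemma upgrades the convergence of the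
    averages to that of the iterates; odd times are even times for [P f].
    Parity has to be separated, since [-1] may belong to the spectrum of [P]. *)
Theorem iter_markov_op_cvg0 f : bounded_nneg_mfun f ->
  (forall x, f x <= 1) -> (\int[la]_x (f x)%:E < +oo)%E ->
  {ae la, forall x, iter n P f x @[n --> \oo] --> 0}.
Proof.
move=> bf f1 foo; have bPf := bounded_nneg_markov_op mu mact bf.
have Pfoo : (\int[la]_x (P f x)%:E < +oo)%E by rewrite int_markov_op.
have ipos n x : 0 <= iter n P f x.
  by case: (bounded_nneg_iter mu mact n bf).
have := square_function_fin mact rev bPf Pfoo.
have := square_function_fin mact rev bf foo.
have := limsup_avg0 bf f1 foo.
apply: filterS3 => x h0 sq0 sq1.
have Ssmall (e : R) : 0 < e -> \forall n \near \oo, S f n x <= e * n%:R.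
  move=> e0; have [N _ hN] := limsup_avg_lt bf f1 (le_lt_trans h0 e0).
  exists N.+1 => // -[//|n] Nn.
  by have := hN n Nn; rewrite /A ler_pdivrMr ?ltr0n.
have Ssmall2 (e : R) : 0 < e -> \forall n \near \oo, S f n.*2 x <= e * n%:R.
  move=> e0; have [|N _ hN] := Ssmall (e / 2); first by rewrite divr_gt0.
  exists N => // n /= Nn; have /= := hN n.*2.
  rewrite -addnn natrD (leq_trans Nn) ?leq_addr// => /(_ isT).
  by rewrite (_ : e / 2 * (n%:R + n%:R) = e * n%:R)//; field.
have Sdouble n : S f n.*2 x =
    \sum_(k < n) iter k.*2 P f x + \sum_(k < n) iter k.*2 P (P f) x.
  elim: n => [|n IH]; first by rewrite /S !big_ord0 addr0.
  rewrite doubleS /S !big_ord_recr/=; rewrite /S in IH; rewrite IH.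
  by rewrite -iterSr -!addrA; congr (_ + _); rewrite addrCA.
have cesaro0 (e : R) : 0 < e ->
    \forall n \near \oo, \sum_(k < n) iter k.*2 P f x <= e * n%:R.
  move=> /Ssmall2; apply: filterS => n; apply: le_trans.
  by rewrite Sdouble lerDl sumr_ge0// => k _; rewrite -iterSr.
have cesaro1 (e : R) : 0 < e ->
    \forall n \near \oo, \sum_(k < n) iter k.*2 P (P f) x <= e * n%:R.
  move=> /Ssmall2; apply: filterS => n; apply: le_trans.
  by rewrite Sdouble lerDr sumr_ge0.
apply/cvgrPdist_le => e e0.
have [N0 _ h0'] := cvg0_of_cesaro (fun n => ipos n.*2 x) sq0 cesaro0 e0.
have [|N1 _ h1'] := cvg0_of_cesaro _ sq1 cesaro1 e0.
  by move=> n; rewrite -iterSr.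
exists (maxn N0 N1).+1.*2 => // n /= Nn.
rewrite sub0r normrN ger0_norm// -(odd_double_half n).
have Nh : (maxn N0 N1 <= n./2)%N.
  by rewrite -leq_double; move: (odd_double_half n) Nn; case: (odd n) => /=; lia.
case: (odd n) => /=; last first.
  by apply: h0' => /=; rewrite (leq_trans _ Nh)// leq_maxl.
have := h1' n./2; rewrite /= -iterSr/=; apply.
by rewrite (leq_trans _ Nh)// leq_maxr.
Qed.

End dissipation.

(** * Continuous actions of second countable groups *)

Section second_countable_spaces.

Lemma countable_basis_seq (T : topologicalType) : @second_countable T ->
  exists B : nat -> set T, (forall n, open (B n)) /\
    forall x U, nbhs x U -> exists n, B n x /\ B n `<=` U.
Proof.
move=> [B /countable_injP[i iinj] [Bopen Bbasis]].
exists (fun n => \bigcup_(U in [set U | B U /\ i U = n]) U); split.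
  by move=> n; apply: bigcup_open => U [BU _]; exact: Bopen.
move=> x U /Bbasis[V [BV Vx] VU]; exists (i V); split; first by exists V.
move=> y [W [BW iW] Wy]; apply: VU.
by rewrite -(iinj W V)// inE.
Qed.

Lemma lcsc_exhaustion (T : topologicalType) : lcsc T ->
  exists V C : nat -> set T, [/\ forall n, open (V n),
    forall n, compact (C n) /\ V n `<=` C n &
    forall K, compact K -> exists n, K `<=` V n].
Proof.
move=> [_ lcT /countable_basis_seq[B [Bopen Bbasis]]].
pose B' n := if `[< precompact (B n) >] then B n else set0.
have B'C n : exists D, compact D /\ B' n `<=` D.
  rewrite /B'; case: ifPn => [/asboolP[D BD [cD _]]|_]; first by exists D.
  by exists set0; split => //; exact: compact0.
have [D BD] := choice B'C.
exists (fun n => \bigcup_(i in `I_n) B' i).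
exists (fun n => \big[setU/set0]_(i < n) D i); split.
- move=> n; apply: bigcup_open => i _; rewrite /B'.
  by case: ifP => // _; exact: open0.
- move=> n; split; first by apply: bigsetU_compact => i _; case: (BD i).
  rewrite -bigcup_mkord => x [i ni Bx]; exists i => //.
  by case: (BD i) => _; exact.
move=> K /compact_near_coveringP ncK.
have [|N _ KN] := ncK nat \oo (fun n x => (\bigcup_(i in `I_n) B' i) x) _.
  move=> x _.
  have [W Wx [cW clW]] : exists2 W, nbhs x W & compact W /\ closed W.
    by have := lcT x I; rewrite withinET.
  have [i [Bx BW]] := Bbasis x _ Wx.
  exists (B i, [set n | (i < n)%N]).
    split; last by exists i.+1.
    by apply: open_nbhs_nbhs; split; [exact: Bopen|].
  move=> [y n] [/= By ni]; exists i => //; rewrite /B' asboolT//.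
  by exists W.
by exists N; exact: (KN N (leqnn N)).
Qed.

(** An open set of the product is a countable union of rectangles with sides in
    the bases, hence belongs to the product of the Borel sigma-algebras. *)
Lemma measurable_fun_continuous_prod (X Y Z : ptopologicalType)
    (f : X * Y -> Z) : @second_countable X -> @second_countable Y ->
  continuous f ->
  measurable_fun setT (f : borel X * borel Y -> borel Z).
Proof.
move=> /countable_basis_seq[A [Aopen Abasis]].
move=> /countable_basis_seq[B [Bopen Bbasis]] cf.
apply: (@measurability _ _ (borel X * borel Y)%type (borel Z) setT f (@open Z))
  => // _ [U oU <-].
rewrite setTI.
pose W n m := if `[< A n `*` B m `<=` f @^-1` U >] then A n `*` B m else set0.
have -> : f @^-1` U = \bigcup_n \bigcup_m W n m.
  apply/seteqP; split => [[x y] Uxy|[x y] [n _ [m _]]]; last first.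
    by rewrite /W; case: ifPn => [/asboolP + Axy|//]; exact.
  have : nbhs (x, y) (f @^-1` U).
    by apply: cf; apply: open_nbhs_nbhs; split.
  move=> [[V1 V2] /= [V1x V2y] VU].
  have [n [Ax AV]] := Abasis _ _ V1x; have [m [By BV]] := Bbasis _ _ V2y.
  exists n => //; exists m => //; rewrite /W asboolT//.
  by move=> [x' y'] [/= /AV Vx' /BV Vy']; exact: (VU (x', y')).
apply: bigcupT_measurable => n; apply: bigcupT_measurable => m.
rewrite /W; case: ifPn => // _.
by apply: measurableX; apply: sub_sigma_algebra; [exact: Aopen|exact: Bopen].
Qed.

Lemma measurable_fun_continuous (X Z : ptopologicalType) (f : X -> Z) :
  continuous f -> measurable_fun setT (f : borel X -> borel Z).
Proof.
move=> cf.
apply: (@measurability _ _ (borel X) (borel Z) setT f (@open Z)) => // _ [U oU <-].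
by rewrite setTI; apply: sub_sigma_algebra; move/continuousP: cf; exact.
Qed.

Lemma measurable_fun_continuous_real {R : realType} (X : ptopologicalType)
    (f : X -> R) : continuous f -> measurable_fun setT (f : borel X -> R).
Proof.
move=> /continuousP cf.
apply: (@measurability _ _ (borel X) R setT f _ (RGenOpens.measurableE R)).
move=> _ [_ [a [b ->] <-]]; rewrite setTI; apply: sub_sigma_algebra.
exact/cf/interval_open.
Qed.

End second_countable_spaces.

Section reversibility.
Context {R : realType} (X : ptopologicalType) (G : topologicalGroupType).
Variable act : G -> X -> X.
Hypothesis hact : continuous_action act.
Hypotheses (scX : @second_countable X) (scG : @second_countable G).

Lemma continuous_act1 g : continuous (act g).
Proof.
have [_ _ cact] := hact; move=> x.
apply: (@continuous_comp _ _ _ (fun x => (g, x)) (fun p => act p.1 p.2)).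
  by apply: cvg_pair; [exact: cvg_cst|exact: cvg_id].
exact: cact.
Qed.

Lemma continuous_orbit x : continuous (act^~ x).
Proof.
have [_ _ cact] := hact; move=> g.
apply: (@continuous_comp _ _ _ (fun g => (g, x)) (fun p => act p.1 p.2)).
  by apply: cvg_pair; [exact: cvg_id|exact: cvg_cst].
exact: cact.
Qed.

Lemma measurable_act :
  measurable_fun setT (fun p : borel G * borel X => act p.1 p.2 : borel X).
Proof.
have [_ _ cact] := hact.
exact: (measurable_fun_continuous_prod scG scX cact).
Qed.

Lemma measurable_act1 g : measurable_fun setT (act g : borel X -> borel X).
Proof. by apply: (@measurable_fun_continuous X X); exact: continuous_act1. Qed.

Lemma actK g x : act (g^-1)%g (act g x) = x.
Proof. by have [act1 actM _] := hact; rewrite -actM mulVg act1. Qed.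

Lemma actVK g x : act g (act (g^-1)%g x) = x.
Proof. by have [act1 actM _] := hact; rewrite -actM mulgV act1. Qed.

Variables (la : {sigma_finite_measure set (borel X) -> \bar R})
  (mu : probability (borel G) R).
Hypotheses (hpres : measure_preserving_action act la)
  (hsym : symmetric_measure mu).

Lemma int_act (k : borel X -> \bar R) (g : G) : measurable_fun setT k ->
  (forall x, 0 <= k x)%E -> (\int[la]_x k (act g x) = \int[la]_x k x)%E.
Proof.
move=> mk k0; have mg := measurable_act1 g.
transitivity (\int[pushforward la (act g : borel X -> borel X)]_x k x)%E.
  by rewrite ge0_integral_pushforward.
apply: eq_measure_integral => A mA _.
exact: hpres.
Qed.

Local Notation P := (markov_op (act : borel G -> borel X -> borel X) mu).

Lemma int_markov_op_mul (u v : borel X -> R) :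
  bounded_nneg_mfun u -> bounded_nneg_mfun v ->
  let J g := (\int[la]_x (u (act g x) * v x)%:E)%E in
  measurable_fun setT (J : borel G -> \bar R) /\
  (\int[la]_x (P u x * v x)%:E = \int[mu]_g J g)%E.
Proof.
move=> bu bv J; have [mfu u0 _] := bu; have [mfv v0 _] := bv.
have mXG : measurable_fun setT
    (fun p : borel X * borel G => act p.2 p.1 : borel X).
  apply: (measurableT_comp measurable_act
    (g := fun p : borel X * borel G => (p.2, p.1))).
  exact: measurable_fun_pair.
pose F (p : borel X * borel G) : \bar R := (u (act p.2 p.1) * v p.1)%:E.
have mF : measurable_fun setT F.
  apply/measurable_EFinP/measurable_funM.
    exact: (measurableT_comp mfu mXG).
  exact: (measurableT_comp mfv measurable_fst).
have F0 p : (0 <= F p)%E by rewrite lee_fin mulr_ge0.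
split; first exact: (measurable_fun_fubini_tonelli_G (m1 := la) _ mF F0).
rewrite -(fubini_tonelli F mF F0).
apply: eq_integral => x _; rewrite EFinM (markov_opE _ measurable_act)//.
rewrite muleC -ge0_integralZl_EFin//.
- by apply: eq_integral => g _; rewrite -EFinM mulrC.
- by move=> g _; rewrite lee_fin.
- by apply: bounded_nneg_EFin; exact: (bounded_nneg_act measurable_act x).
Qed.

(** Detailed balance: moving the integrand by [g] replaces [g] by its inverse
    on the other factor, and [mu] does not see the difference. *)
Lemma markov_op_reversible (f h : borel X -> R) :
  bounded_nneg_mfun f -> bounded_nneg_mfun h ->
  (\int[la]_x (P f x * h x)%:E = \int[la]_x (f x * P h x)%:E)%E.
Proof.
move=> bf bh; have [mf f0 _] := bf; have [mh h0 _] := bh.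
under [RHS]eq_integral do rewrite mulrC.
have [_ ->] := int_markov_op_mul bf bh.
have [mJ ->] := int_markov_op_mul bh bf.
move: mJ; set J := (J in measurable_fun _ J) => mJ.
have J0 g : (0 <= J g)%E by apply: ge0_int_EFin => x; rewrite mulr_ge0.
have minv : measurable_fun setT ((fun g => g^-1%g) : borel G -> borel G).
  by apply: (@measurable_fun_continuous G G); exact: invg_continuous.
transitivity (\int[mu]_g J (g^-1)%g)%E.
  apply: eq_integral => g _.
  pose k x := (h (act (g^-1)%g x) * f x)%:E.
  transitivity (\int[la]_x k (act g x))%E.
    by apply: eq_integral => x _; rewrite /k actK mulrC.
  apply: int_act; last by move=> x; rewrite lee_fin mulr_ge0.
  apply/measurable_EFinP/measurable_funM => //.
  exact: (measurableT_comp mh (measurable_act1 _)).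
transitivity
  (\int[pushforward mu ((fun g => g^-1%g) : borel G -> borel G)]_g J g)%E.
  by rewrite ge0_integral_pushforward.
by apply: eq_measure_integral => A mA _; exact: hsym.
Qed.

End reversibility.

(** * Invariance up to null sets *)

Section symmetric_difference.
Context {d} {T : measurableType d} {R : realType}.
Variable m : {measure set T -> \bar R}.
Implicit Types A B C : set T.

Lemma measurableY A B : measurable A -> measurable B -> measurable (A `+` B).
Proof. by move=> mA mB; apply: measurableU; exact: measurableD. Qed.

Lemma measureY0_trans A B C :
  measurable A -> measurable B -> measurable C ->
  m (A `+` B) = 0%E -> m (B `+` C) = 0%E -> m (A `+` C) = 0%E.
Proof.
move=> mA mB mC AB BC.
have U0 := measureU0 (measurableY mA mB) (measurableY mB mC) BC.
apply: (subset_measure0 _ _ _ (etrans U0 AB)).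
- exact: measurableY.
- by apply: measurableU; exact: measurableY.
- by move=> x /=; have [Bx|Bx] := pselect (B x); tauto.
Qed.

Lemma measureY0_half A B : measurable A -> measurable B ->
  m A = m B -> (m B < +oo)%E -> m (A `\` B) = 0%E -> m (A `+` B) = 0%E.
Proof.
move=> mA mB AB Boo D0.
have Ifin : m (A `&` B) \is a fin_num.
  rewrite ge0_fin_numE//; apply: le_lt_trans Boo.
  by apply: le_measure; rewrite ?inE//; exact: measurableI.
have D0' : m (B `\` A) = 0%E.
  have EB : (m (B `\` A) = m B - m (B `&` A))%E := measureD mB mA Boo.
  have EA : (m A = m (A `\` B) + m (A `&` B))%E := measureDI m mA mB.
  by rewrite EB setIC -AB EA D0 add0e subee.
exact: etrans (measureU0 (measurableD mA mB) (measurableD mB mA) D0') D0.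
Qed.

Lemma ae_measure0 (P : T -> Prop) (A : set T) : measurable A ->
  {ae m, forall x, P x} -> (forall x, A x -> ~ P x) -> m A = 0%E.
Proof.
move=> mA [N [mN N0 PN]] AP; apply: (subset_measure0 mA mN _ N0).
by move=> x /AP nP; exact: PN.
Qed.

End symmetric_difference.

Section borel_sets.
Variable T : ptopologicalType.

Lemma open_measurable_borel (U : set (borel T)) :
  open (U : set T) -> measurable U.
Proof. exact: sub_sigma_algebra. Qed.

Lemma compact_measurable_borel (K : set (borel T)) :
  hausdorff_space T -> compact (K : set T) -> measurable K.
Proof.
move=> hT cK; rewrite -[K]setCK; apply: measurableC.
by apply: open_measurable_borel; apply: closed_openC; exact: compact_closed.
Qed.

End borel_sets.

Section stabilizer.
Context {R : realType} (X : ptopologicalType) (G : topologicalGroupType).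
Variable act : G -> X -> X.
Hypothesis hact : continuous_action act.
Hypothesis hausX : hausdorff_space X.
Variables (la : {measure set (borel X) -> \bar R}).
Hypotheses (hla : radon la) (hpres : measure_preserving_action act la).

Lemma measurable_preimage_act g (A : set (borel X)) : measurable A ->
  measurable (act g @^-1` A : set (borel X)).
Proof.
by move=> mA; rewrite -[X in measurable X]setTI; exact: (measurable_act1 hact).
Qed.

Lemma measure_preimage_act g (A : set (borel X)) : measurable A ->
  la (act g @^-1` A) = la A.
Proof. exact: hpres. Qed.

(** Preimages by [g], which are images by its inverse, are measurable at once;
    for a subgroup the distinction is immaterial. *)
Definition stabilizer (E : set (borel X)) : set G :=
  [set g | la ((act g @^-1` E : set (borel X)) `+` E) = 0%E].

Variable E : set (borel X).
Hypotheses (mE : measurable E) (Eoo : (la E < +oo)%E).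

Let mgE g : measurable (act g @^-1` E : set (borel X)).
Proof. exact: measurable_preimage_act. Qed.

(** A translate of [E] has the measure of [E], so one half of the symmetric
    difference is negligible as soon as the other one is. *)
Lemma stabilizer_half g :
  la ((act g @^-1` E) `\` E) = 0%E -> stabilizer E g.
Proof.
by move=> D0; apply: measureY0_half => //; exact: measure_preimage_act.
Qed.

Lemma stabilizer_group_closed : group_closed (fun g => g \in stabilizer E).
Proof.
have [act1 actM _] := hact.
have in_stab g : stabilizer E g -> g \in (fun g => g \in stabilizer E : bool).
  by move=> Eg; exact: (mem_set Eg).
split.
  apply: in_stab; apply: stabilizer_half.
  rewrite (_ : act 1%g @^-1` E = E) ?setDv ?measure0//.
  by apply/seteqP; split => x /=; rewrite act1.
move=> u v uE0 vE0; apply: in_stab.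
have uE : stabilizer E u := set_mem uE0.
have vE : stabilizer E v := set_mem vE0.
have translate0 (w h : G) : stabilizer E h ->
    la (act w @^-1` ((act h @^-1` E : set (borel X)) `+` E)) = 0%E.
  by move=> hE; rewrite measure_preimage_act//; exact: measurableY.
apply: (@measureY0_trans _ _ _ la _ (act (v^-1)%g @^-1` E)) => //.
  have -> : act (u / v)%g @^-1` E = act (v^-1)%g @^-1` (act u @^-1` E).
    by apply/seteqP; split => x /=; rewrite actM.
  exact: translate0 uE.
rewrite setYC; have := translate0 (v^-1)%g v vE.
congr (la _ = _); apply/seteqP; split => x /=; rewrite -actM mulgV act1; tauto.
Qed.

(** If [E] lies in an open set [U] of almost the same measure, every [g'] close
    to [g] satisfies that the union of [U] and its [g']-translate contains a
    given compact part of the union of [U] and its [g]-translate. When [g']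
    stabilizes [E], that union has measure at most [la E + 2 e]. *)
Lemma stabilizer_closed : closed (stabilizer E : set G).
Proof.
have [_ _ cact] := hact; have [_ outer inner] := hla.
have Efin : la E \is a fin_num by rewrite ge0_fin_numE.
move=> g clg; apply: stabilizer_half.
have mgEE : measurable ((act g @^-1` E : set (borel X)) `\` E).
  exact: measurableD.
suff small (e : R) : 0 < e ->
    (la ((act g @^-1` E : set (borel X)) `|` E) <= la E + (e + e)%:E)%E.
  have UE : la ((act g @^-1` E : set (borel X)) `|` E) =
      (la E + la ((act g @^-1` E : set (borel X)) `\` E))%E.
    have -> : (act g @^-1` E : set (borel X)) `|` E =
        E `|` ((act g @^-1` E : set (borel X)) `\` E).
      by apply/seteqP; split => x /=; have [Ex|Ex] := pselect (E x); tauto.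
    apply: measureU => //; apply/seteqP; split => x //=; tauto.
  apply/eqP; rewrite eq_le measure_ge0 andbT.
  apply/lee_addgt0Pr => e e0; rewrite add0e.
  have := small (e / 2); rewrite divr_gt0// => /(_ isT).
  by rewrite UE -splitr leeD2lE.
move=> e0.
have [U [oU EU] Ue] : exists2 U : set X, open U /\ E `<=` U &
    (la U < la E + e%:E)%E.
  have : ereal_inf [set la U | U in [set U : set X | open U /\ E `<=` U]]
      \is a fin_num by rewrite -outer.
  move=> /(lb_ereal_inf_adherent e0)[_ [U oEU <-]]; rewrite -outer// => Ue.
  by exists U.
have mU : measurable (U : set (borel X)) by exact: open_measurable_borel.
have mgU h : measurable (act h @^-1` U : set (borel X)).
  exact: measurable_preimage_act.
have UEe : (la ((U : set (borel X)) `\` E) <= e%:E)%E.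
  rewrite measureD//; last by rewrite (lt_trans Ue)// lte_add_pinfty// ltry.
  by rewrite (setIidr EU) leeBlDr// addeC ltW.
apply: (@le_trans _ _ (la ((act g @^-1` U : set (borel X)) `|` U))).
  apply: le_measure; rewrite ?inE; try exact: measurableU.
  by move=> x [/EU|/EU]; [left|right].
have oV : open (act g @^-1` U `|` U : set X).
  apply: openU => //; apply: open_comp => // x _; exact: continuous_act1.
rewrite inner//; apply: ge_ereal_sup => _ [K [cK KV] <-].
have mK : measurable (K : set (borel X)) by exact: compact_measurable_borel.
have near_g : \forall g' \near g, K `<=` (fun x => U (act g' x) \/ U x).
  have ncK := (compact_near_coveringP K).1 cK.
  apply: (ncK G (nbhs g) (fun g' x => U (act g' x) \/ U x)) => x /KV[Ugx|Ux].
    have : nbhs (g, x) ((fun p => act p.1 p.2) @^-1` U).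
      by apply: cact; exact: open_nbhs_nbhs.
    move=> [[V1 V2] /= [V1g V2x] VU]; exists (V2, V1) => //.
    by move=> [x' g'] [/= V2x' V1g']; left; exact: (VU (g', x')).
  exists (U, setT); first by split; [exact: open_nbhs_nbhs|exact: filterT].
  by move=> [x' g'] [/= Ux' _]; right.
have [g' [g'E Kg']] := clg _ near_g.
have mgEE' : measurable ((act g' @^-1` E : set (borel X)) `\` E).
  exact: measurableD.
have mUE : measurable ((U : set (borel X)) `\` E) by exact: measurableD.
have g'E0 : la ((act g' @^-1` E : set (borel X)) `\` E) = 0%E.
  apply: (subset_measure0 mgEE' (measurableY (mgE g') mE) _ g'E).
  by move=> x; left.
have mgUE :
    measurable (act g' @^-1` ((U : set (borel X)) `\` E) : set (borel X)).
  exact: measurable_preimage_act.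
apply: (@le_trans _ _ (la (((act g' @^-1` E : set (borel X)) `\` E) `|`
    ((act g' @^-1` ((U : set (borel X)) `\` E)) `|` U)))).
  apply: le_measure; rewrite ?inE//.
    by apply: measurableU => //; exact: measurableU.
  move=> x /Kg'[Ug'x|Ux]; last by right; right.
  have [Eg'x|Eg'x] := pselect (E (act g' x)); last by right; left.
  have [Ex|Ex] := pselect (E x); last by left.
  by right; right; exact: EU.
apply: (le_trans (measureU2 _ _ _)) => //; first exact: measurableU.
rewrite [X in (X + _)%E]g'E0 add0e; apply: (le_trans (measureU2 _ _ _)) => //.
rewrite [X in (X + _)%E]measure_preimage_act// addeC EFinD addeA.
by rewrite leeD// ltW.
Qed.

End stabilizer.

Section finite_invariant_sets.
Context {R : realType} (X : ptopologicalType) (G : topologicalGroupType).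
Variable act : G -> X -> X.
Hypotheses (hact : continuous_action act) (hX : lcsc X) (hG : lcsc G).
Variables (la : {sigma_finite_measure set (borel X) -> \bar R})
  (mu : probability (borel G) R).
Hypotheses (hla : radon la) (hpres : measure_preserving_action act la)
  (hgen : smallest (@closed_subgroup G) (measure_support mu) = [set: G]).

Local Notation P := (markov_op (act : borel G -> borel X -> borel X) mu).

Let hausX : hausdorff_space X. Proof. by case: hX. Qed.
Let scX : @second_countable X. Proof. by case: hX. Qed.
Let scG : @second_countable G. Proof. by case: hG. Qed.

(** The mean over [g] of the measure of the points outside [E] that [g] moves
    into [E] is zero, so almost every [g] stabilizes [E]. The complement of the
    stabilizer is then a negligible open set, which avoids the support. *)
Lemma stabilizer_setT (E : set (borel X)) :
  measurable E -> (la E < +oo)%E ->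
  {ae la, forall x, P \1_E x <= \1_E x} -> stabilizer act la E = [set: G].
Proof.
move=> mE Eoo PE.
have mgE g : measurable (act g @^-1` E : set (borel X)).
  exact: measurable_preimage_act.
have b1 := bounded_nneg_indic (R := R) mE.
have bC := bounded_nneg_indic (R := R) (measurableC mE).
have [mJ] := int_markov_op_mul hact scX scG la mu b1 bC.
set J := (J in measurable_fun _ J) in mJ *.
have JE g : J g = la ((act g @^-1` E : set (borel X)) `\` E).
  rewrite /J -[X in la X]setIT -integral_indic//; last exact: measurableD.
  apply: eq_integral => x _; congr EFin.
  by rewrite !indicE in_setC in_setD -natrM mulnb andbC.
have zero : (\int[la]_x
    (markov_op (act : borel G -> borel X -> borel X) mu \1_E x * \1_(~` E) x)%:E
    = 0)%E.
  have bPE := bounded_nneg_markov_op mu (measurable_act hact scX scG) b1.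
  rewrite (@ge0_ae_eq_integral _ _ _ la setT _ (cst 0%E))//= ?integral0//.
  - by apply: bounded_nneg_EFin; exact: bounded_nneg_mul.
  - by move=> x _; have [_ PE0 _] := bPE; rewrite lee_fin mulr_ge0.
  - move: PE; apply: filterS => x PEx _ /=; congr EFin; move: PEx.
    rewrite !indicE in_setC; case: (x \in E) => /=; rewrite ?mulr0// mulr1.
    by move=> PE0; apply/eqP; rewrite eq_le PE0; have [_ ->] := bPE.
rewrite zero => /esym intJ.
have aeJ : {ae mu, forall g, J g = 0%E}.
  have /(ae_eq_integral_abs mu measurableT mJ) : (\int[mu]_g `|J g| = 0)%E.
    by rewrite -intJ; apply: eq_integral => g _; rewrite gee0_abs// JE.
  by apply: filterS => g; exact.
have supp : measure_support mu `<=` stabilizer act la E.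
  move=> g suppg; apply: contrapT => ng.
  have op : open_nbhs g (~` (stabilizer act la E)).
    split => //; apply: closed_openC.
    exact: (stabilizer_closed hact hausX hla hpres mE Eoo).
  have := suppg _ op; rewrite (_ : mu _ = 0%E) ?ltxx//.
  apply: (ae_measure0 _ aeJ); first by apply: open_measurable_borel; case: op.
  by move=> h nh Jh; apply: nh; apply: (stabilizer_half hact hpres mE Eoo);
    exact: etrans (esym (JE h)) Jh.
apply/seteqP; split => // g _; have := I : [set: G] g; rewrite -hgen; apply.
split => //; split; first exact: stabilizer_closed.
exact: stabilizer_group_closed.
Qed.

Lemma finite_invariant_set0 (E : set (borel X)) :
  (forall A : set (borel X), measurable A -> invariant_set act la A ->
    la A = 0%E \/ la A = +oo%E) ->
  measurable E -> (la E < +oo)%E ->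
  {ae la, forall x, P \1_E x <= \1_E x} -> la E = 0%E.
Proof.
move=> hinv mE Eoo PE; have stabT := stabilizer_setT mE Eoo PE.
have invE : invariant_set act la E.
  move=> g; have : stabilizer act la E (g^-1)%g by rewrite stabT.
  rewrite /stabilizer/=; congr (la (_ `+` _) = _).
  apply/seteqP; split => [x /= Ex|_ [x Ex <-]]/=; last by rewrite (actK hact).
  by exists (act (g^-1)%g x) => //; exact: actVK.
have [//|Einf] := hinv E mE invE.
by move: Eoo; rewrite [X in (X < _)%E]Einf ltxx.
Qed.

End finite_invariant_sets.

(** * Laws of the walk *)

Section walk_law.
Context {R : realType} (X : ptopologicalType) (G : topologicalGroupType).
Variable act : G -> X -> X.
Hypothesis hact : continuous_action act.
Hypotheses (scX : @second_countable X) (scG : @second_countable G).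
Variable mu : probability (borel G) R.

Local Notation P := (markov_op (act : borel G -> borel X -> borel X) mu).

Let mact := measurable_act hact scX scG.

(** The last step of the walk is the left factor of the product. Tonelli's
    theorem integrates it first, which replaces [f] by [P f]. *)
Lemma convolution_power_markov_op n : exists m : probability (borel G) R,
  convolution_power mu n = m /\
  forall (f : borel X -> R) x, bounded_nneg_mfun f ->
    (\int[m]_h (f (act h x))%:E = (iter n P f x)%:E)%E.
Proof.
have [act1 actM cact] := hact.
elim: n => [|n [m [mE IH]]].
  exists (\d_(1%g : borel G)); split => // f x bf.
  rewrite integral_dirac//; first by rewrite diracT mul1e act1.
  by apply: bounded_nneg_EFin; exact: (bounded_nneg_act mact x).
have mmul : measurable_fun setT
    ((fun p => (p.1 * p.2)%g) : borel G * borel G -> borel G).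
  exact: (measurable_fun_continuous_prod scG scG (@mulg_continuous G)).
pose mul : {mfun (borel G * borel G)%type >-> borel G} :=
  HB.pack ((fun p => (p.1 * p.2)%g) : borel G * borel G -> borel G)
    (isMeasurableFun.Build _ _ _ _ _ mmul).
exists (distribution (mu \x m)%E mul); split.
  by rewrite /convolution_power iterS -/(convolution_power mu n) mE.
move=> f x bf; have [mf f0 _] := bf.
have bfx : bounded_nneg_mfun (fun g : borel G => f (act g x)).
  exact: (bounded_nneg_act mact x).
have mF : measurable_fun setT
    (fun p : borel G * borel G => (f (act (p.1 * p.2)%g x))%:E).
  exact: (measurableT_comp (bounded_nneg_EFin bfx) mmul).
have F0 (p : borel G * borel G) : (0 <= (f (act (p.1 * p.2)%g x))%:E)%E.
  by rewrite lee_fin.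
rewrite ge0_integral_pushforward//; last 2 first.
- exact: (bounded_nneg_EFin bfx).
- by move=> g _; rewrite lee_fin.
rewrite preimage_setT (fubini_tonelli2 _ mF F0) iterSr -IH; last first.
  exact: bounded_nneg_markov_op.
apply: eq_integral => h _; rewrite (markov_opE _ mact)//.
by apply: eq_integral => g _ /=; rewrite actM.
Qed.

Lemma walk_law_markov_op n x : exists nu : probability (borel X) R,
  walk_law act mu n x = nu /\
  forall f : borel X -> R, bounded_nneg_mfun f ->
    (\int[nu]_y (f y)%:E = (iter n P f x)%:E)%E.
Proof.
have [m [mE mP]] := convolution_power_markov_op n.
have morb : measurable_fun setT ((fun g => act g x) : borel G -> borel X).
  by apply: (@measurable_fun_continuous G X); exact: continuous_orbit.
pose orb : {mfun borel G >-> borel X} :=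
  HB.pack ((fun g => act g x) : borel G -> borel X)
    (isMeasurableFun.Build _ _ _ _ _ morb).
exists (distribution m orb); split; first by rewrite /walk_law mE.
move=> f bf; rewrite ge0_integral_pushforward//; last 2 first.
- exact: bounded_nneg_EFin.
- by move=> y _; rewrite lee_fin; case: bf.
by rewrite preimage_setT -mP.
Qed.

End walk_law.

(** The proof of sigma-finiteness is an argument, so that the instances below
    can be inferred from the term. *)
Definition sigma_finite_measure_of d (T : measurableType d) (R : realType)
  (m : {measure set T -> \bar R}) (sf : sigma_finite setT m) :
  set T -> \bar R := m.

Section sigma_finite_measure_of_instances.
Context d (T : measurableType d) (R : realType).
Variables (m : {measure set T -> \bar R}) (sf : sigma_finite setT m).

HB.instance Definition _ := Measure.copy (sigma_finite_measure_of sf) m.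
HB.instance Definition _ :=
  Measure_isSigmaFinite.Build d T R (sigma_finite_measure_of sf) sf.

End sigma_finite_measure_of_instances.

(** The image of the support is compact, hence bounded. *)
Lemma compact_support_bound {R : realType} (X : topologicalType) (f : X -> R) :
  continuous f -> compact (closure [set x | f x != 0]) ->
  exists2 M : R, 0 <= M &
    forall x, `|f x| <= M * \1_(closure [set x | f x != 0]) x.
Proof.
move=> cf; set K := closure _ => cK.
have : compact (f @` K).
  by apply: continuous_compact => //; exact: continuous_subspaceT.
move=> /compact_bounded[M0 [_ hM]].
exists (Num.max 0 (M0 + 1)); first by rewrite le_max lexx.
move=> x; rewrite indicE; have [xK|xK] := boolP (x \in K); last first.
  rewrite mulr0 normr_le0; apply: contraNT xK => fx0.
  by rewrite inE; apply: subset_closure.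
rewrite mulr1 (le_trans (hM (M0 + 1) _ (f x) _)) ?ltrDl//.
  by exists x => //; rewrite inE in xK.
by rewrite le_max lexx orbT.
Qed.

Lemma sigma_finite_radon {R : realType} (X : ptopologicalType)
    (la : {measure set (borel X) -> \bar R}) :
  lcsc X -> radon la -> sigma_finite [set: borel X] la.
Proof.
move=> hX [laK _ _]; have [hausX _ _] := hX.
have [V [C [Vopen VC Vexh]]] := lcsc_exhaustion hX.
exists V.
  apply/seteqP; split => // x _.
  have cx : compact [set x : X] by exact: compact_set1.
  by have [n xV] := Vexh _ cx; exists n => //; exact: xV.
move=> n; have mV : measurable (V n : set (borel X)).
  exact: open_measurable_borel.
split => //; have [cC VCn] := VC n; apply: le_lt_trans (laK _ cC).
apply: le_measure; rewrite ?inE//; exact: compact_measurable_borel.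
Qed.

Section vanishing.
Context {R : realType} (X : ptopologicalType) (G : topologicalGroupType).
Variable act : G -> X -> X.
Hypothesis hact : continuous_action act.
Hypotheses (scX : @second_countable X) (scG : @second_countable G).
Variables (mu : probability (borel G) R) (V : nat -> set X).
Hypotheses (Vopen : forall n, open (V n))
  (Vexh : forall K, compact K -> exists n, K `<=` V n).

Local Notation P := (markov_op (act : borel G -> borel X -> borel X) mu).

(** A test function is dominated by a multiple of the indicator of a set
    [V N] that contains its support. *)
Lemma walk_law_weak_star_cvg0 x :
  (forall n, iter k P \1_(V n) x @[k --> \oo] --> 0) ->
  weak_star_cvg (fun n => walk_law act mu n x) mzero.
Proof.
move=> cvgV f cf cK.
have [M M0 fM] := compact_support_bound cf cK.
have [N KN] := Vexh cK.
rewrite integral_measure_zero.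
have bV : bounded_nneg_mfun (\1_(V N) : borel X -> R).
  by apply: bounded_nneg_indic; exact: open_measurable_borel.
have bMV : bounded_nneg_mfun (fun y : borel X => M * \1_(V N) y).
  by apply: bounded_nneg_mul => //; exact: bounded_nneg_cst.
have fMV y : `|f y| <= M * \1_(V N) y.
  apply: (le_trans (fM y)); rewrite ler_wpM2l// !indicE ler_nat.
  case: (boolP (_ \in closure _)) => // yK.
  by rewrite mem_set//; exact/KN/set_mem.
have bnd n : (`|\int[walk_law act mu n x]_y (f y)%:E| <=
    (M * iter n P \1_(V N) x)%:E)%E.
  have [nu [-> nuE]] := walk_law_markov_op hact scX scG mu n x.
  have mf : measurable_fun setT (f : borel X -> R).
    exact: measurable_fun_continuous_real.
  apply: (le_trans (le_abse_integral _ _ _)) => //; first exact/measurable_EFinP.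
  rewrite EFinM -nuE// -int_EFinZ//.
  apply: ge0_le_integral => //.
  - by apply: measurableT_comp => //; exact/measurable_EFinP.
  - exact: bounded_nneg_EFin.
  - by move=> y _; rewrite /= lee_fin.
apply/cvg_abse0P; apply: (@squeeze_cvge _ _ _ _ (cst 0%E) _
  (fun n => (M * iter n P \1_(V N) x)%:E)).
- by apply: nearW => n; rewrite abse_ge0 bnd.
- exact: cvg_cst.
- apply: cvg_EFin; first exact: nearW.
  by have := @cvgMr R _ _ _ _ M _ (cvgV N); rewrite mulr0; exact.
Qed.

Variable la : {measure set (borel X) -> \bar R}.

Lemma int_indic_exhaustion_fin (C : nat -> set X) n : hausdorff_space X ->
  radon la -> (forall n, compact (C n) /\ V n `<=` C n) ->
  (\int[la]_x (\1_(V n) x)%:E < +oo)%E.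
Proof.
move=> hausX [laK _ _] VC; have [cC VCn] := VC n.
have mV : measurable (V n : set (borel X)) by exact: open_measurable_borel.
rewrite integral_indic// setIT; apply: le_lt_trans (laK _ cC).
by apply: le_measure; rewrite ?inE//; exact: compact_measurable_borel.
Qed.

End vanishing.

Local Open Scope ereal_scope.

Theorem theorem1 (R : realType)
    (X : ptopologicalType) (hX : lcsc X)
    (la : {measure set (borel X) -> \bar R}) (hla : radon la)
    (G : topologicalGroupType) (hG : lcsc G)
    (act : G -> X -> X) (hact : continuous_action act)
    (hpres : measure_preserving_action act la)
    (mu : probability (borel G) R)
    (hgen : smallest (@closed_subgroup G) (measure_support mu) = [set: G])
    (hsym : symmetric_measure mu)
    (hinv : forall A : set (borel X), measurable A -> invariant_set act la A ->
      la A = 0 \/ la A = +oo) :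
  {ae la, forall x : X, weak_star_cvg (fun n => walk_law act mu n x) mzero}.
Proof.
have [hausX _ scX] := hX; have [_ _ scG] := hG.
pose la' : {sigma_finite_measure set (borel X) -> \bar R} :=
  sigma_finite_measure_of (sigma_finite_radon hX hla).
have [V [C [Vopen VC Vexh]]] := lcsc_exhaustion hX.
have bV n : bounded_nneg_mfun (\1_(V n) : borel X -> R).
  by apply: bounded_nneg_indic; exact: open_measurable_borel.
have V1 n (x : borel X) : (\1_(V n) x <= 1 :> R)%R.
  by rewrite indicE; case: (_ \in _).
have noinv E mE Eoo PE := @finite_invariant_set0 _ _ _ _ hact hX hG la' mu
  hla hpres hgen E hinv mE Eoo PE.
have cvgV : {ae la', forall x, forall n,
    iter k (markov_op (act : borel G -> borel X -> borel X) mu)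
      (\1_(V n)) x @[k --> \oo] --> 0%R}.
  apply/ae_foralln => n; apply: (iter_markov_op_cvg0 _ _ noinv) => //.
  - exact: measurable_act.
  - exact: markov_op_reversible.
  - exact: (int_indic_exhaustion_fin Vopen n hausX hla VC).
apply: filterS cvgV => x; exact: walk_law_weak_star_cvg0.
Qed.
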